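(* Under the hypotheses of Theorem 1 (connectivity-based model, $d\in\{2,3\}$, $\alpha\in(0,1]$, $\beta\in[0,d)$, $R>(1/\alpha)^{1/d}R_{\mathrm{MDS}}$ with $R_{\mathrm{MDS}}=32\left(\frac{12\log n}{\alpha(n-2)}\right)^{1/d}$), with high probability $$\min_{S\in\mathbb R^{d\times d}}\frac{1}{\sqrt n}\|LX-L\widehat X S\|_F\le \sqrt6\left(\frac{R_{\mathrm{MDS}}}{R}+20R\right).$$
   Context: Model: $n$ nodes at positions $x_1,\dots,x_n$ i.i.d. uniform in $[0,1]^d$; $X$ is the $n\times d$ matrix with rows $x_i$; $d_{i,j}=\|x_i-x_j\|$. Detection function $p(z)=\min\{1,\alpha(z/R)^{-\beta}\}$. Connectivity-based model: independently for each pair, $\{i,j\}$ is an edge of $G$ with probability $p(d_{i,j})$ if $d_{i,j}\le R$ and never if $d_{i,j}>R$; only $G$ is observed. $h_{i,j}$ is the hop count (graph distance) in $G$ and $\hat d_{i,j}=Rh_{i,j}$. MDS-MAP: $\widehat D_{ij}=\hat d_{i,j}^2$ ($i\ne j$), $\widehat D_{ii}=0$; $L=I_n-\frac1n\mathbf 1_n\mathbf 1_n^T$; $M=-\tfrac12 L\widehat DL$; $\widehat X=U_d\Sigma_d^{1/2}$ where $U_d\Sigma_dU_d^T$ is the best rank-$d$ approximation of $M$ (top $d$ eigenvalues and orthonormal eigenvectors). $\|\cdot\|_F$ is the Frobenius norm. *)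

(* Defs.v *)
From HB Require Import structures.
From mathcomp Require Import all_boot all_order all_algebra.
From mathcomp Require Import all_classical all_reals all_analysis.
Set Implicit Arguments. Unset Strict Implicit. Unset Printing Implicit Defensive.
Import Order.TTheory GRing.Theory Num.Theory.
Local Open Scope ring_scope.
Local Open Scope classical_set_scope.

Section MDSMAP.
Variable R : realType.

(* Iterated integral of f over the cube [0,1]^N (coordinates listed in a seq):
   this is the expectation w.r.t. N i.i.d. Uniform[0,1] coordinates. *)
Fixpoint cube_int (N : nat) (f : seq R -> R) : R :=
  match N with
  | 0 => f [::]
  | N'.+1 => Rintegral lebesgue_measure `[0%R, 1%R]
               (fun t => cube_int N' (fun s => f (t :: s)))
  end.

(* positions: the n x d matrix X whose rows are the x_i, read from n*d
   uniform coordinates *)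
Definition posX (n d : nat) (s : seq R) : 'M[R]_(n, d) :=
  \matrix_(i < n, k < d) nth 0 s (i * d + k).

Definition dist (n d : nat) (X : 'M[R]_(n, d)) (i j : 'I_n) : R :=
  Num.sqrt (\sum_(k < d) (X i k - X j k) ^+ 2).

Definition detect (alpha beta Rr z : R) : R :=
  if z == 0 then 1 else Num.min 1 (alpha * powR (z / Rr) (- beta)).

Definition edge_prob (n d : nat) (alpha beta Rr : R) (X : 'M[R]_(n, d))
    (i j : 'I_n) : R :=
  if dist X i j <= Rr then detect alpha beta Rr (dist X i j) else 0.

(* A graph outcome: one boolean coin per ordered pair; only the pairs
   (i,j) with i < j are used (entries with i >= j are forced false). *)
Definition graph (n : nat) := {ffun 'I_n * 'I_n -> bool}.

Definition adj (n : nat) (g : graph n) (i j : 'I_n) : bool :=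
  if (i < j)%N then g (i, j) else if (j < i)%N then g (j, i) else false.

Definition graph_weight (n d : nat) (alpha beta Rr : R) (X : 'M[R]_(n, d))
    (g : graph n) : R :=
  \prod_(ij : 'I_n * 'I_n)
     (if (ij.1 < ij.2)%N then
        (if g ij then edge_prob alpha beta Rr X ij.1 ij.2
         else 1 - edge_prob alpha beta Rr X ij.1 ij.2)
      else (if g ij then 0 else 1)).

Definition model_prob (n d : nat) (alpha beta Rr : R)
    (E : 'M[R]_(n, d) -> graph n -> Prop) : R :=
  cube_int (n * d) (fun s =>
    \sum_(g : graph n)
       graph_weight alpha beta Rr (posX n d s) g * (`[< E (posX n d s) g >])%:R).

Definition ball_k (n : nat) (g : graph n) (i : 'I_n) (k : nat) : {set 'I_n} :=
  iter k (fun B => B :|: [set y | [exists x in B, adj g x y]]%SET) [set i]%SET.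

(* hop count h_{i,j} (graph distance); equals n when j is unreachable *)
Definition hop (n : nat) (g : graph n) (i j : 'I_n) : nat :=
  find (fun k => j \in ball_k g i k) (iota 0 n).

Definition connected (n : nat) (g : graph n) : Prop :=
  forall i j : 'I_n, (hop g i j < n)%N.

Definition Dhat (n : nat) (Rr : R) (g : graph n) : 'M[R]_n :=
  \matrix_(i, j) if i == j then 0 else (Rr * (hop g i j)%:R) ^+ 2.

Definition Lmat (n : nat) : 'M[R]_n := 1%:M - (n%:R)^-1 *: const_mx 1.

Definition Mmat (n : nat) (Rr : R) (g : graph n) : 'M[R]_n :=
  (- (1 / 2)) *: (Lmat n *m Dhat Rr g *m Lmat n).

Definition top_eig (n d : nat) (M : 'M[R]_n) (U : 'M[R]_(n, d))
    (sig : 'rV[R]_d) : Prop :=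
  [/\ U^T *m U = 1%:M,
      M *m U = U *m diag_mx sig &
      forall (v : 'cV[R]_n) (lam : R), v != 0 -> U^T *m v = 0 ->
        M *m v = lam *: v -> forall k, lam <= sig 0 k].

Definition Xhat (n d : nat) (U : 'M[R]_(n, d)) (sig : 'rV[R]_d) : 'M[R]_(n, d) :=
  U *m diag_mx (map_mx Num.sqrt sig).

Definition frob (m k : nat) (A : 'M[R]_(m, k)) : R :=
  Num.sqrt (\sum_(i < m) \sum_(j < k) A i j ^+ 2).

Definition R_MDS (n d : nat) (alpha : R) : R :=
  32 * powR (12 * ln (n%:R) / (alpha * (n%:R - 2))) (d%:R)^-1.

(* the event of Theorem 2: G is connected (so MDS-MAP is defined) and,
   for every valid choice of the top-d eigendecomposition of M,
   min_S (1/sqrt n) ||L X - L \hat X S||_F <= sqrt 6 (R_MDS/R + 20 R) *)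
Definition thm2_event (n d : nat) (alpha Rr : R) (X : 'M[R]_(n, d))
    (g : graph n) : Prop :=
  connected g /\
  forall (U : 'M[R]_(n, d)) (sig : 'rV[R]_d), top_eig (Mmat Rr g) U sig ->
    exists S : 'M[R]_d,
      (Num.sqrt (n%:R))^-1 * frob (Lmat n *m X - Lmat n *m Xhat U sig *m S)
      <= Num.sqrt 6 * (R_MDS n d alpha / Rr + 20 * Rr).

End MDSMAP.

(* Main.v *)
Require Import Defs.
From HB Require Import structures.
From mathcomp Require Import all_boot all_order all_algebra.
From mathcomp Require Import all_classical all_reals all_analysis.
From mathcomp Require Import ring lra zify.
Set Implicit Arguments. Unset Strict Implicit. Unset Printing Implicit Defensive.
Import Order.TTheory GRing.Theory Num.Theory.
Import numFieldNormedType.Exports.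
Local Open Scope ring_scope.
Local Open Scope classical_set_scope.

(** Write s = R_MDS / 32, so that alpha (n-2) s^d = 12 ln n. With probability
    1 - O(1/n) three things hold.
    (1) Every far pair (|x_i - x_j| > R) has a neighbour k of i with
    |x_k - x_j| <= |x_i - x_j| - (R - 18 s / 5): it suffices that one of the
    n - 2 other nodes falls into a cube of side s placed on the segment from
    x_i to x_j and is joined to i, which fails with probability
    (1 - alpha s^d)^(n-2) <= n^(-12).
    (2) Every near pair has a common neighbour, by the same argument with a
    cube of side R/32 at the midpoint and edge probability alpha^2; this is
    where R > alpha^(-1/d) R_MDS enters.
    (3) The empirical covariance of the positions is close to I/12 (Chebyshev).
    Greedy routing gives |x_i - x_j| <= R h_ij <= (1 + delta) |x_i - x_j| + 2R
    with delta of order R_MDS / R, hence M = Y Y^T + E with Y = L X and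
    |E|_F <= n (11/50) x, where x = R_MDS/R + 20 R. If x >= 21/100 the choice
    S = 0 suffices. Otherwise let P be the projection on the eigenvectors of
    the top d eigenvalues that are positive; a Davis-Kahan argument bounds
    (1 - P) Y, and P Y is of the form Xhat S. *)

(** * Perturbation of the top eigenspace *)

(** The obstacle is that the conditional probability of the event, as a function of the positions,
    is never shown to be measurable, so its iterated integral can be neither computed nor split.
    Instead an explicit minorant [1 - fail_bound] is built whose iterated integral is known exactly
    ([cint]), and monotonicity of the integral of nonnegative functions transfers the bound to
    [cube_int]. This dictates the shape of every failure bound: a finite sum of products of
    functions of one node each. The cube in which a relay is sought depends on both x_i and x_j,
    which breaks that shape; it is therefore attached to a pair of grid cells containing the two
    points, and the mesh is fine enough that this costs only s/10. The numerical constants are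
    rational stand-ins, with slack so that linear arithmetic closes the inequalities; for instance
    7/4 stands for sqrt 3. *)

Section Frobenius.
Variable R : realType.

Definition dotm m n (A B : 'M[R]_(m, n)) : R := \tr (A^T *m B).

Lemma dotmE m n (A B : 'M[R]_(m, n)) :
  dotm A B = \sum_i \sum_j A i j * B i j.
Proof.
rewrite /dotm /mxtrace exchange_big /=; apply: eq_bigr => j _.
by rewrite mxE; apply: eq_bigr => i _; rewrite mxE.
Qed.

Lemma dotmC m n (A B : 'M[R]_(m, n)) : dotm A B = dotm B A.
Proof. by rewrite !dotmE; apply: eq_bigr => i _; apply: eq_bigr => j _; rewrite mulrC. Qed.

Lemma dotmDl m n (A B C : 'M[R]_(m, n)) : dotm (A + B) C = dotm A C + dotm B C.
Proof. by rewrite /dotm linearD /= mulmxDl linearD. Qed.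

Lemma dotmZl m n a (A B : 'M[R]_(m, n)) : dotm (a *: A) B = a * dotm A B.
Proof. by rewrite /dotm linearZ /= -scalemxAl linearZ. Qed.

Lemma dotmDr m n (A B C : 'M[R]_(m, n)) : dotm A (B + C) = dotm A B + dotm A C.
Proof. by rewrite dotmC dotmDl !(dotmC A). Qed.

Lemma dotmZr m n a (A B : 'M[R]_(m, n)) : dotm A (a *: B) = a * dotm A B.
Proof. by rewrite dotmC dotmZl dotmC. Qed.

Lemma dotmNr m n (A B : 'M[R]_(m, n)) : dotm A (- B) = - dotm A B.
Proof. by rewrite -scaleN1r dotmZr mulN1r. Qed.

Lemma dotm0r m n (A : 'M[R]_(m, n)) : dotm A 0 = 0.
Proof. by rewrite -(scale0r 0) dotmZr mul0r. Qed.

Lemma dotm_ge0 m n (A : 'M[R]_(m, n)) : 0 <= dotm A A.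
Proof.
by rewrite dotmE; apply: sumr_ge0 => i _; apply: sumr_ge0 => j _; rewrite -expr2 sqr_ge0.
Qed.

Lemma dotm_eq0 m n (A : 'M[R]_(m, n)) : dotm A A = 0 -> A = 0.
Proof.
rewrite dotmE => /eqP; rewrite psumr_eq0; last first.
  by move=> i _; apply: sumr_ge0 => j _; rewrite -expr2 sqr_ge0.
move=> /allP H; apply/matrixP => i j; rewrite mxE.
have := H i; rewrite mem_index_enum => /(_ isT) /=.
rewrite psumr_eq0; last by move=> k _; rewrite -expr2 sqr_ge0.
move=> /allP /(_ j); rewrite mem_index_enum => /(_ isT) /=.
by rewrite mulf_eq0 orbb => /eqP.
Qed.

Lemma dotm_gt0 m n (A : 'M[R]_(m, n)) : A != 0 -> 0 < dotm A A.
Proof.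
move=> A0; rewrite lt_neqAle dotm_ge0 andbT eq_sym.
by apply: contra A0 => /eqP/dotm_eq0 ->.
Qed.

Lemma dotm_mull m n p (P : 'M[R]_(m, n)) (A : 'M[R]_(n, p)) B :
  dotm (P *m A) B = dotm A (P^T *m B).
Proof. by rewrite /dotm trmx_mul mulmxA. Qed.

Lemma dotm_mulr m n p (P : 'M[R]_(n, p)) (A : 'M[R]_(m, n)) B :
  dotm (A *m P) B = dotm A (B *m P^T).
Proof. by rewrite /dotm trmx_mul -mulmxA mxtrace_mulC -mulmxA. Qed.

Lemma dotm_tr m n (A B : 'M[R]_(m, n)) : dotm A^T B^T = dotm A B.
Proof.
by rewrite !dotmE exchange_big; apply: eq_bigr => i _; apply: eq_bigr => j _; rewrite !mxE.
Qed.

Lemma dotm_CS m n (A B : 'M[R]_(m, n)) :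
  dotm A B ^+ 2 <= dotm A A * dotm B B.
Proof.
have [->|A0] := eqVneq A 0.
  by rewrite [dotm 0 B]dotmC !dotm0r expr0n /= mul0r.
have a0 := dotm_gt0 A0.
have := dotm_ge0 (dotm A A *: B - dotm A B *: A).
rewrite !(dotmDl, dotmDr, dotmZl, dotmZr, =^~ scaleNr).
rewrite (dotmC B A); set a := dotm A A in a0 *; set b := dotm A B.
set c := dotm B B => H.
have : 0 <= a * (a * c - b ^+ 2) by move: H; nra.
by rewrite pmulr_rge0 // subr_ge0.
Qed.

Lemma dotm_CS_le m n (A B : 'M[R]_(m, n)) a b : 0 <= a -> 0 <= b ->
  dotm A A <= a ^+ 2 -> dotm B B <= b ^+ 2 -> dotm A B <= a * b.
Proof.
move=> a0 b0 Aa Bb; apply: le_trans (ler_norm _) _.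
rewrite -(@ler_pXn2r _ 2) ?nnegrE ?mulr_ge0 // real_normK ?num_real //.
apply: le_trans (dotm_CS _ _) _.
by rewrite exprMn; apply: ler_pM => //; apply: dotm_ge0.
Qed.

(** The quadratic form is the inner product of [E] with w w^T, whose Frobenius norm is |w|^2, so
    Cauchy-Schwarz bounds it by the Frobenius norm of [E]. *)
Lemma dotm_form_le n (E : 'M[R]_n) (w : 'cV[R]_n) e : 0 <= e ->
  dotm E E <= e ^+ 2 -> dotm w (E *m w) <= e * dotm w w.
Proof.
move=> e0 Ee.
have -> : dotm w (E *m w) = dotm E (w *m w^T).
  by rewrite dotmC dotm_mulr.
apply: dotm_CS_le => //; first exact: dotm_ge0.
have wwE : w^T *m w = (dotm w w)%:M.
  by rewrite [LHS]mx11_scalar /dotm /mxtrace big_ord1.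
rewrite dotm_mull mulmxA wwE mul_scalar_mx dotmZr dotm_tr expr2 //.
Qed.

Lemma frobE m n (A : 'M[R]_(m, n)) : frob A = Num.sqrt (dotm A A).
Proof.
by rewrite /frob dotmE; congr Num.sqrt; apply: eq_bigr => i _; apply: eq_bigr => j _;
   rewrite expr2.
Qed.

End Frobenius.

(** * Eigenvectors as maximisers of a quadratic form *)

Section Rayleigh.
Variable R : realType.

Let cts_form n (M : 'M[R]_n) :
  continuous (fun x : 'rV[R]_n => dotm x^T (M *m x^T)).
Proof.
have -> : (fun x : 'rV[R]_n => dotm x^T (M *m x^T)) =
  (fun x : 'rV[R]_n => \sum_i \sum_j (x 0 i * (M i j * x 0 j))).
  apply/funext => x; rewrite dotmE; apply: eq_bigr => i _.
  rewrite big_ord1 !mxE mulr_sumr; apply: eq_bigr => j _.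
  by rewrite !mxE.
apply: continuous_big => [|i _]; first exact: add_continuous.
apply: continuous_big => [|j _ x]; first exact: add_continuous.
have cc k : {for x, continuous (fun y : 'rV[R]_n => y 0 k)} by exact: coord_continuous.
apply: (continuousM (cc i)).
by apply: (continuousM _ (cc j)); exact: cst_continuous.
Qed.

(** The form attains its maximum on the compact set of unit vectors killed by U^T. The residual z =
    M v - mu v at a maximiser v is again killed by U^T, and moving v along z would increase the
    quotient unless z = 0. *)
Lemma rayleigh n d (M : 'M[R]_n) (U : 'M[R]_(n, d)) : M^T = M ->
  (forall v : 'cV[R]_n, U^T *m v = 0 -> U^T *m (M *m v) = 0) ->
  (exists2 v : 'cV[R]_n, v != 0 & U^T *m v = 0) ->
  exists (v : 'cV[R]_n) (mu : R), [/\ v != 0, U^T *m v = 0, M *m v = mu *: v &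
    forall w : 'cV[R]_n, U^T *m w = 0 -> dotm w (M *m w) <= mu * dotm w w].
Proof.
move=> Ms MU [v0 v0n0 Uv0].
pose S1 := [set x : 'rV[R]_n | dotm x^T (1%:M *m x^T) = 1].
(* The constraint U^T x = 0 is written as |U^T x|^2 = 0, so that both constraints are level sets of
   a quadratic form and one continuity lemma closes them. *)
pose S2 := [set x : 'rV[R]_n | dotm x^T ((U *m U^T) *m x^T) = 0].
have S2E (x : 'rV[R]_n) : S2 x <-> U^T *m x^T = 0.
  rewrite /S2 /= -mulmxA -{1}(trmxK U) -dotm_mull; split; first exact: dotm_eq0.
  by move=> ->; rewrite dotm0r.
have nrm (w : 'cV[R]_n) : w != 0 -> U^T *m w = 0 ->
    (S1 `&` S2) ((Num.sqrt (dotm w w))^-1 *: w^T).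
  move=> w0 Uw; split; last first.
    by apply/S2E; rewrite linearZ /= trmxK -scalemxAr Uw scaler0.
  rewrite /S1 /= linearZ /= trmxK mul1mx dotmZl dotmZr mulrA -expr2 exprVn.
  by rewrite sqr_sqrtr ?dotm_ge0 // mulVf // gt_eqF // dotm_gt0.
have cl N (c : R) : closed [set x : 'rV[R]_n | dotm x^T (N *m x^T) = c].
  have /continuous_closedP/(_ [set c]) := @cts_form n N; apply.
  exact: closed_eq.
have cK : compact (S1 `&` S2).
  apply: bounded_closed_compact.
    exists 1; split=> // B B1 x [Sx _].
    rewrite /= [`|x|]/Num.norm /= mx_normrE; apply/bigmax_leP.
    split; first by lra.
    move=> [i j] _ /=; rewrite ord1.
    have : `|x 0 j| ^+ 2 <= 1.
      rewrite real_normK ?num_real //.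
      rewrite -Sx mul1mx dotmE; under eq_bigr do rewrite big_ord1 mxE.
      rewrite (bigD1 j) //= -expr2 lerDl; apply: sumr_ge0 => k _.
      by rewrite -expr2 sqr_ge0.
    by rewrite expr_le1 // => H; lra.
  by apply: closedI; [have := cl 1%:M 1 | have := cl (U *m U^T) 0].
have [x] := @EVT_max_rV R n (fun x => dotm x^T (M *m x^T)) (S1 `&` S2)
  (ex_intro _ _ (nrm _ v0n0 Uv0)) cK (continuous_subspaceT (@cts_form n M)).
rewrite inE => -[Sx1 Sx2] xmax; set mu := dotm x^T (M *m x^T) in xmax.
have Ux : U^T *m x^T = 0 by apply/S2E.
have maxw (w : 'cV[R]_n) : U^T *m w = 0 -> dotm w (M *m w) <= mu * dotm w w.
  move=> Uw; have [->|w0] := eqVneq w 0; first by rewrite mulmx0 !dotm0r mulr0.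
  have := xmax _ (mem_set (nrm _ w0 Uw)).
  rewrite linearZ /= trmxK -scalemxAr dotmZl dotmZr mulrA -expr2 exprVn.
  by rewrite sqr_sqrtr ?dotm_ge0 // mulrC ler_pdivrMr // dotm_gt0.
exists x^T, mu; split => //.
  apply/eqP => x0; move: Sx1; rewrite /S1 /= x0 mulmx0 dotm0r => /eqP.
  by rewrite eq_sym oner_eq0.
apply/eqP; rewrite -subr_eq0; apply/eqP.
set v := x^T in Sx1 Ux *; set z := M *m v - mu *: v.
have vv : dotm v v = 1 by move: Sx1; rewrite /S1 /= mul1mx.
have Uz : U^T *m z = 0.
  by rewrite /z mulmxBr MU // -scalemxAr Ux scaler0 subr0.
have zz : dotm v (M *m z) - mu * dotm v z = dotm z z.
  rewrite [dotm v (M *m z)]dotmC dotm_mull Ms (dotmC v z).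
  have -> : dotm z z = dotm z (M *m v - mu *: v) by [].
  by rewrite dotmDr dotmNr dotmZr.
clearbody z.
(* Maximality tested at v + t z; the first order coefficient is -2 |z|^2 by [zz]. *)
have key t : 0 <= 2 * t * - dotm z z + t ^+ 2 * (mu * dotm z z - dotm z (M *m z)).
  have Uvz : U^T *m (v + t *: z) = 0 by rewrite mulmxDr -scalemxAr Ux Uz scaler0 addr0.
  have := maxw _ Uvz.
  rewrite mulmxDr -scalemxAr !(dotmDl, dotmDr, dotmZl, dotmZr).
  have -> : dotm z (M *m v) = dotm v (M *m z).
    by rewrite dotmC dotm_mull Ms.
  have -> : dotm v (M *m v) = mu by [].
  rewrite vv (dotmC z v); move: zz.
  set a := dotm v (M *m z); set b := dotm v z; set c := dotm z z.
  by set f := dotm z (M *m z); nra.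
apply: dotm_eq0; apply/eqP; rewrite eq_le dotm_ge0 andbT leNgt; apply/negP => z0.
set c := dotm z z in z0 key; set f := mu * c - _ in key.
have f0 : 0 <= f by have := maxw _ Uz; rewrite /f /c; lra.
have fc : 0 < f + c by lra.
(* Dividing by f + c instead of f also covers f = 0; this t makes the expression equal to - t c -
   t^2 c < 0. *)
have := key (c / (f + c)).
set t := c / (f + c).
have t0 : 0 < t by rewrite divr_gt0.
have tf : t * (f + c) = c by rewrite /t divfK // gt_eqF.
by nra.
Qed.

End Rayleigh.

(** * A Davis-Kahan estimate for the computed embedding *)

Section Perturbation.
Variable R : realType.

Lemma dotm_col m n (A B : 'M[R]_(m, n)) :
  dotm A B = \sum_j dotm (col j A) (col j B).
Proof.
rewrite dotmE exchange_big; apply: eq_bigr => j _.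
by rewrite dotmE; apply: eq_bigr => i _; rewrite big_ord1 !mxE.
Qed.

Lemma dotm_row m n (A B : 'M[R]_(m, n)) :
  dotm A B = \sum_i dotm (row i A) (row i B).
Proof.
rewrite dotmE; apply: eq_bigr => i _.
by rewrite dotmE big_ord1; apply: eq_bigr => j _; rewrite !mxE.
Qed.

Lemma dotm_diag d (s : 'rV[R]_d) (c : 'cV[R]_d) :
  dotm c (diag_mx s *m c) = \sum_k s 0 k * c k 0 ^+ 2.
Proof.
rewrite dotmE; apply: eq_bigr => k _.
by rewrite big_ord1 mul_diag_mx mxE; ring.
Qed.

Variables (n d : nat) (M : 'M[R]_n) (Y : 'M[R]_(n, d)).
Variables (U : 'M[R]_(n, d)) (sig : 'rV[R]_d) (e : R).
Hypothesis Ms : M^T = M.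
Hypothesis topU : top_eig M U sig.
Hypothesis e0 : 0 <= e.
Hypothesis Ele : dotm (M - Y *m Y^T) (M - Y *m Y^T) <= e ^+ 2.

Let UU : U^T *m U = 1%:M. Proof. by case: topU. Qed.
Let MU : M *m U = U *m diag_mx sig. Proof. by case: topU. Qed.

Let UM : U^T *m M = diag_mx sig *m U^T.
Proof. by rewrite -[in LHS]Ms -trmx_mul MU trmx_mul tr_diag_mx. Qed.

Let dotU (p : nat) (a b : 'M[R]_(d, p)) : dotm (U *m a) (U *m b) = dotm a b.
Proof. by rewrite dotm_mull mulmxA UU mul1mx. Qed.

Let dotUv p (a : 'M[R]_(d, p)) (v : 'M[R]_(n, p)) : U^T *m v = 0 ->
  dotm (U *m a) v = 0.
Proof. by move=> Uv; rewrite dotm_mull Uv dotm0r. Qed.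

(* The largest eigenvalue [mu] of [M] on the complement of [U] is at most [e]:
   some [w != 0] in the [d+1]-dimensional span of [U] and its eigenvector is
   killed by [Y^T], and there [M] is both at least [mu] and at most [e]. *)
Lemma top_eig_compl_form (w : 'cV[R]_n) : U^T *m w = 0 ->
  dotm w (M *m w) <= e * dotm w w.
Proof.
move=> Uw; have [->|w0] := eqVneq w 0; first by rewrite mulmx0 !dotm0r mulr0.
have MUc (v : 'cV[R]_n) : U^T *m v = 0 -> U^T *m (M *m v) = 0.
  by move=> Uv; rewrite mulmxA UM -mulmxA Uv mulmx0.
have [v [mu [v0 Uv Mv mumax]]] := rayleigh Ms MUc (ex_intro2 _ _ w w0 Uw).
apply: (le_trans (mumax _ Uw)); apply: ler_wpM2r; first exact: dotm_ge0.
have [_ _ /(_ v mu v0 Uv Mv) musig] := topU.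
pose B := col_mx U^T v^T *m Y.
have : kermx B != 0.
  rewrite kermx_eq0 /row_free neq_ltn; apply/orP; left.
  by rewrite (leq_ltn_trans (rank_leq_col _)) // addn1.
move=> /rowV0Pn [x /sub_kermxP xB x0].
pose c := (lsubmx x)^T; pose t := rsubmx x 0 0.
pose z := U *m c + t *: v.
have zE : x *m col_mx U^T v^T = z^T.
  rewrite -{1}(hsubmxK x) mul_row_col /z linearD /= trmx_mul trmxK linearZ /=.
  by rewrite [rsubmx x]mx11_scalar mul_scalar_mx.
have Yz : Y^T *m z = 0.
  by apply: trmx_inj; rewrite trmx_mul trmxK trmx0 -zE -mulmxA.
have zz : dotm z z = dotm c c + t ^+ 2 * dotm v v.
  rewrite /z dotmDl !dotmDr !dotmZr !dotmZl [dotm v (U *m _)]dotmC (dotUv _ Uv) dotU.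
  by rewrite !mulr0 addr0 add0r mulrA expr2.
have cc0 : 0 <= dotm c c by exact: dotm_ge0.
have tv0 : 0 <= t ^+ 2 * dotm v v by exact: mulr_ge0 (sqr_ge0 _) (dotm_ge0 _).
have zz0 : 0 < dotm z z.
  rewrite zz lt_neqAle; apply/andP; split; last first.
    exact: addr_ge0.
  rewrite eq_sym paddr_eq0 //.
  rewrite mulf_eq0 sqrf_eq0 [dotm v v == 0]gt_eqF ?dotm_gt0 // orbF.
  apply: contra x0 => /andP [/eqP/dotm_eq0 c0 /eqP tt0].
  rewrite -(hsubmxK x) -[lsubmx x]trmxK -/c c0 trmx0 [rsubmx x]mx11_scalar -/t tt0.
  by rewrite -scalemx1 scale0r row_mx0.
have Mz : dotm z (M *m z) = \sum_k sig 0 k * c k 0 ^+ 2 + t ^+ 2 * mu * dotm v v.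
  have -> : M *m z = U *m (diag_mx sig *m c) + (t * mu) *: v.
    by rewrite /z mulmxDr mulmxA MU mulmxA -scalemxAr Mv scalerA.
  rewrite /z dotmDl !dotmDr !dotmZr !dotmZl [dotm v (U *m _)]dotmC.
  by rewrite !(dotUv _ Uv) dotU dotm_diag; ring.
have low : mu * dotm z z <= dotm z (M *m z).
  rewrite Mz zz mulrDr lerD //; last by rewrite le_eqVlt; apply/orP; left; apply/eqP; ring.
  rewrite dotmE mulr_sumr; apply: ler_sum => k _.
  by rewrite big_ord1 -expr2 ler_wpM2r // sqr_ge0.
have up : dotm z (M *m z) <= e * dotm z z.
  have -> : M *m z = (M - Y *m Y^T) *m z.
    by rewrite mulmxBl -mulmxA Yz mulmx0 subr0.
  exact: dotm_form_le.
by rewrite -(ler_pM2r zz0) (le_trans low).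
Qed.

(** [Num.sqrt] vanishes at nonpositive arguments, so the columns of [Xhat] for nonpositive
    eigenvalues are zero, and only the eigenvectors with positive eigenvalue can be reached by
    [Xhat U sig *m S]. *)
Let chi : 'rV[R]_d := \row_k ((0 < sig 0 k)%R)%:R.
Let P := U *m diag_mx chi *m U^T.
Let Q := 1%:M - P.

Let chichi : diag_mx chi *m diag_mx chi = diag_mx chi.
Proof.
rewrite mulmx_diag; congr diag_mx; apply/rowP => k; rewrite !mxE.
by case: (0 < _); rewrite ?mulr1 ?mulr0.
Qed.

Let Ps : P^T = P.
Proof. by rewrite /P !trmx_mul trmxK tr_diag_mx mulmxA. Qed.

Let PP : P *m P = P.
Proof.
by rewrite /P !mulmxA -[U *m diag_mx chi *m U^T *m U]mulmxA UU mulmx1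
  -[U *m _ *m diag_mx chi]mulmxA chichi.
Qed.

Let QQ : Q *m Q = Q.
Proof. by rewrite /Q mulmxBl mul1mx mulmxBr mulmx1 PP subrr subr0. Qed.

Let Qs : Q^T = Q. Proof. by rewrite /Q linearB /= Ps trmx1. Qed.

Let QM : Q *m M = M *m Q.
Proof.
rewrite /Q mulmxBl mulmxBr mulmx1 mul1mx /P; congr (_ - _).
rewrite -!mulmxA UM [RHS]mulmxA MU !mulmxA; congr (_ *m _).
by rewrite -!mulmxA diag_mxC.
Qed.

Let DQ : diag_mx chi *m U^T *m Q = 0.
Proof.
have DP : diag_mx chi *m U^T *m P = diag_mx chi *m (U^T *m U) *m diag_mx chi *m U^T.
  by rewrite /P !mulmxA.
by rewrite /Q mulmxBr mulmx1 DP UU mulmx1 chichi subrr.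
Qed.

(** A vector in the range of [Q] splits into a combination of columns of [U] with nonpositive
    eigenvalues, where the form is at most 0, and a part orthogonal to [U], where
    [top_eig_compl_form] applies. *)
Let form_Q (v : 'cV[R]_n) : dotm (Q *m v) (M *m (Q *m v)) <= e * dotm (Q *m v) (Q *m v).
Proof.
set z := Q *m v; pose c := U^T *m z; pose q := z - U *m c.
have Uq : U^T *m q = 0 by rewrite /q mulmxBr [U^T *m (U *m _)]mulmxA UU mul1mx subrr.
have zE : z = U *m c + q by rewrite /q addrC subrK.
have cE k : (0 < sig 0 k) -> c k 0 = 0.
  move=> sk.
  have : (diag_mx chi *m c) k 0 = 0.
    by rewrite /c /z !mulmxA DQ mul0mx mxE.
  by rewrite mul_diag_mx !mxE sk mul1r.
clearbody q; clearbody c; clearbody z.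
have -> : dotm z (M *m z) = \sum_k sig 0 k * c k 0 ^+ 2 + dotm q (M *m q).
  rewrite zE mulmxDr mulmxA MU -mulmxA dotmDl !dotmDr dotU dotm_diag.
  rewrite (dotUv _ (v := M *m q)); last by rewrite mulmxA UM -mulmxA Uq mulmx0.
  by rewrite [dotm q (U *m _)]dotmC (dotUv _ Uq) addr0 add0r.
have -> : dotm z z = dotm c c + dotm q q.
  by rewrite zE dotmDl !dotmDr dotU [dotm q (U *m _)]dotmC !(dotUv _ Uq) addr0 add0r.
rewrite mulrDr; apply: lerD; last exact: top_eig_compl_form.
apply: (@le_trans _ _ 0); last by rewrite mulr_ge0 // dotm_ge0.
apply: sumr_le0 => k _; have [sk|sk] := ltP 0 (sig 0 k).
  by rewrite cE // expr0n mulr0.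
by rewrite mulr_le0_ge0 // sqr_ge0.
Qed.

(** With Z = Q Y, W = Z Y^T and a = |W|, the square a^2 is at least lam |Z|^2 and at most e |Z|^2 +
    a e. Eliminating |Z| from the upper bound gives a (lam - e) <= lam e, and the lower bound turns
    this into a bound on |Z|. *)
Lemma top_eig_perturb lam : e < lam ->
  (forall c : 'rV[R]_d, lam * dotm c c <= dotm c (c *m (Y^T *m Y))) ->
  exists S : 'M[R]_d,
    (lam - e) ^+ 2 * dotm (Y - Xhat U sig *m S) (Y - Xhat U sig *m S)
    <= lam * e ^+ 2.
Proof.
move=> elam lamY.
pose T : 'rV[R]_d := \row_k (if 0 < sig 0 k then (Num.sqrt (sig 0 k))^-1 else 0).
(* [T] inverts the square roots of the positive eigenvalues, so [Xhat] times this matrix is P Y. *)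
exists (diag_mx T *m (U^T *m Y)).
have -> : Y - Xhat U sig *m (diag_mx T *m (U^T *m Y)) = Q *m Y.
  rewrite /Q mulmxBl mul1mx /P /Xhat !mulmxA -[U *m _ *m diag_mx T]mulmxA.
  congr (_ - U *m _ *m _ *m _); rewrite mulmx_diag; congr diag_mx.
  apply/rowP => k; rewrite !mxE; case: ltP => s0; last by rewrite mulr0.
  by rewrite mulfV // gt_eqF // sqrtr_gt0.
set Z := Q *m Y; set E := M - Y *m Y^T; pose W := Z *m Y^T.
have WE : W = Q *m (Y *m Y^T) by rewrite /W /Z mulmxA.
have QW : Q *m W = W by rewrite WE mulmxA QQ.
have eqW : dotm W W = dotm Z (M *m Z) - dotm W E.
  have -> : dotm Z (M *m Z) = dotm W M.
    have -> : dotm W M = dotm Z (M *m Y) by rewrite {1}/W (dotm_mulr Y^T Z) trmxK.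
    have -> : M *m Z = Q^T *m (M *m Y) by rewrite Qs [RHS]mulmxA QM -mulmxA.
    by rewrite -(dotm_mull Q Z) /Z mulmxA QQ.
  have -> : dotm W W = dotm W (Y *m Y^T) by rewrite {2}WE -{1}Qs -(dotm_mull Q W) QW.
  rewrite -dotmNr -dotmDr; congr dotm; by rewrite /E opprB addrC subrK.
have ZMZ : dotm Z (M *m Z) <= e * dotm Z Z.
  rewrite dotm_col [dotm Z Z]dotm_col mulr_sumr; apply: ler_sum => j _.
  have colM (A : 'M[R]_n) (B : 'M[R]_(n, d)) : col j (A *m B) = A *m col j B.
    by rewrite !colE mulmxA.
  by rewrite colM /Z !colM form_Q.
have lamZ : lam * dotm Z Z <= dotm W W.
  have -> : dotm W W = dotm Z (Z *m (Y^T *m Y)) by rewrite {1}/W (dotm_mulr Y^T Z) trmxK mulmxA.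
  rewrite dotm_row [dotm Z (_ *m _)]dotm_row mulr_sumr; apply: ler_sum => j _.
  by rewrite [row j (Z *m _)]row_mul; exact: lamY.
pose a := Num.sqrt (dotm W W).
have a0 : 0 <= a by exact: sqrtr_ge0.
have aE : dotm W W = a ^+ 2 by rewrite sqr_sqrtr // dotm_ge0.
have WEle : - dotm W E <= a * e.
  rewrite -dotmNr; apply: dotm_CS_le => //; first by rewrite aE.
  by rewrite dotmNr dotmC dotmNr opprK.
rewrite aE in eqW lamZ.
set z := dotm Z Z in ZMZ lamZ *.
have lam0 : 0 < lam by apply: le_lt_trans elam.
have z0 : 0 <= z by exact: dotm_ge0.
have h1 : a * (a * (lam - e)) <= a * (lam * e).
  have : lam * a ^+ 2 <= lam * (e * z + a * e) by rewrite ler_pM2l // eqW; lra.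
  have : e * (lam * z) <= e * a ^+ 2 by rewrite ler_wpM2l.
  by nra.
have h2 : a * (lam - e) <= lam * e.
  have [a00|ap] := eqVneq a 0.
    by rewrite a00 mul0r mulr_ge0 // ltW.
  by move: h1; rewrite ler_pM2l // lt_neqAle eq_sym ap.
rewrite -(ler_pM2l lam0).
apply: (@le_trans _ _ ((a * (lam - e)) ^+ 2)).
  rewrite exprMn mulrCA mulrC ler_wpM2r // ?sqr_ge0 //.
have -> : lam * (lam * e ^+ 2) = (lam * e) ^+ 2 by ring.
by rewrite ler_pXn2r // nnegrE ?mulr_ge0 // ?subr_ge0 ltW.
Qed.

End Perturbation.

(** * Iterated integrals over the cube *)

Section CubeIntegral.
Variable R : realType.
Local Notation mu := (@lebesgue_measure R).
Local Notation I01 := (`[0%R, 1%R]%classic : set R).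

(* [integral] of a nonnegative function is a supremum over simple functions,
   so it is monotone even without measurability. *)
Lemma ge0_le_integral_nomeas (d : measure_display) (T : measurableType d)
    (nu : {measure set T -> \bar R}) (D : set T) (f g : T -> \bar R) :
  (forall x, D x -> (0 <= f x)%E) -> (forall x, D x -> (f x <= g x)%E) ->
  (\int[nu]_(x in D) f x <= \int[nu]_(x in D) g x)%E.
Proof.
move=> f0 fg.
have g0 x : D x -> (0 <= g x)%E by move=> Dx; exact: le_trans (f0 _ Dx) (fg _ Dx).
rewrite !ge0_integralE //; apply: le_ereal_sup => _ [h hf <-]; exists h => // x.
apply: (le_trans (hf x)); rewrite /patch; case: ifPn => // xD.
by apply: fg; rewrite inE in xD.
Qed.

Lemma mu01 : mu I01 = 1%E.
Proof. by rewrite lebesgue_measure_itv /= lte_fin ltr01 oppr0 adde0. Qed.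

Lemma integrable01_cst (c : R) : mu.-integrable I01 (EFin \o cst c).
Proof.
apply: continuous_compact_integrable; first exact: segment_compact.
by apply: continuous_subspaceT => x; exact: cst_continuous.
Qed.

Lemma Rintegral01_cst (c : R) : Rintegral mu I01 (fun=> c) = c.
Proof.
rewrite Rintegral_cst //; apply: etrans (mulr1 _); congr (_ * _).
exact: (congr1 fine mu01).
Qed.

(** [h] may be negative, so the comparison passes through its positive part. The bounds on [q] make
    its integral finite, hence [fine] does not send it to a default value. *)
Lemma Rintegral01_le_nomeas (h q : R -> R) : mu.-integrable I01 (EFin \o h) ->
  (forall t, I01 t -> 0 <= q t <= 1) -> (forall t, I01 t -> h t <= q t) ->
  Rintegral mu I01 h <= Rintegral mu I01 q.
Proof.
move=> ih q01 hq.
have q0 t : I01 t -> (0 <= (q t)%:E)%E by move=> /q01 /andP[]; rewrite lee_fin.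
have qle : (\int[mu]_(x in I01) (q x)%:E <= 1)%E.
  have -> : 1%E = (\int[mu]_(x in I01) (cst 1%E) x)%E.
    by rewrite integral_cst // mul1e; exact/esym/mu01.
  apply: ge0_le_integral_nomeas => // t /q01 /andP[_]; by rewrite lee_fin.
have qge : (0 <= \int[mu]_(x in I01) (q x)%:E)%E by exact: integral_ge0.
have qfin : (\int[mu]_(x in I01) (q x)%:E)%E \is a fin_num.
  by rewrite ge0_fin_numE // (le_lt_trans qle) // ltry.
rewrite /Rintegral; apply: fine_le => //.
  by apply: integrable_fin_num.
apply: (@le_trans _ _ (\int[mu]_(x in I01) ((EFin \o h)^\+ x))%E).
  rewrite [leLHS]integralE leeBlDr.
    by apply: leeDl; apply: integral_ge0 => x _; exact: funeneg_ge0.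
  by apply: integrable_fin_num => //; exact: integrable_funeneg.
apply: ge0_le_integral_nomeas => [x _|x Ix]; first exact: funepos_ge0.
by rewrite funeposE /= -EFin_max lee_fin ge_max hq //; case/andP: (q01 _ Ix).
Qed.

Fixpoint in_cube (N : nat) (s : seq R) : Prop :=
  match N, s with
  | 0%N, [::] => True
  | N'.+1, t :: s' => (0 <= t <= 1) /\ in_cube N' s'
  | _, _ => False
  end.

(** An index past the end is harmless: [nth] then returns its default 0, which lies in the unit
    interval. *)
Lemma in_cube_nth N s i : in_cube N s -> 0 <= nth 0 s i <= 1.
Proof.
elim: N s i => [|N IH] [|t s] [|i] //=; rewrite ?lexx ?ler01 //; first by case.
by move=> [_ /IH].
Qed.

(* [cint N F c]: the iterated integral of [F] is [c], all sections being
   integrable, so that [c] never hides the junk value of [Rintegral]. *)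
Fixpoint cint (N : nat) (F : seq R -> R) (c : R) : Prop :=
  match N with
  | 0%N => F [::] = c
  | N'.+1 => exists h : R -> R, [/\ mu.-integrable I01 (EFin \o h),
      forall t, 0 <= t <= 1 -> cint N' (fun s => F (t :: s)) (h t) &
      Rintegral mu I01 h = c]
  end.

(** The range of [f] is carried along because each inner integral becomes the integrand of the next
    one, and the one-dimensional comparison needs it to lie in [0,1]. *)
Lemma le_cube_int N F f c : cint N F c ->
  (forall s, in_cube N s -> 0 <= f s <= 1) ->
  (forall s, in_cube N s -> F s <= f s) ->
  0 <= cube_int N f <= 1 /\ c <= cube_int N f.
Proof.
elim: N F f c => [|N IH] F f c /=.
  by move=> <- f01 Ff; rewrite f01 // Ff.
move=> [h [ih hF <-]] f01 Ff.
pose q t := cube_int N (fun s => f (t :: s)).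
have qP t : I01 t -> 0 <= q t <= 1 /\ h t <= q t.
  rewrite /= in_itv /= => t01; apply: (IH _ _ _ (hF _ t01)) => s s01.
    exact: f01.
  exact: Ff.
have le0 : Rintegral mu I01 (fun=> 0) <= Rintegral mu I01 q.
  apply: Rintegral01_le_nomeas => [|t /qP[]//|t /qP[/andP[]]//].
  exact: integrable01_cst.
have le1 : Rintegral mu I01 q <= 1.
  have q1 : (\int[mu]_(x in I01) (q x)%:E <= 1)%E.
    have -> : 1%E = (\int[mu]_(x in I01) (cst 1%E) x)%E.
      by rewrite integral_cst // mul1e; exact/esym/mu01.
    by apply: ge0_le_integral_nomeas => t /qP[/andP[? ?] _]; rewrite lee_fin.
  rewrite /Rintegral (_ : 1 = fine 1%E) //; apply: fine_le => //.
  rewrite ge0_fin_numE ?(le_lt_trans q1) ?ltry //.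
  by apply: integral_ge0 => t /qP[/andP[? ?] _]; rewrite lee_fin.
rewrite Rintegral01_cst in le0; split; first by rewrite le0 le1.
by apply: Rintegral01_le_nomeas => // t /qP[].
Qed.

Lemma eq_cint N F G c : (forall s, in_cube N s -> F s = G s) ->
  cint N F c -> cint N G c.
Proof.
elim: N F G c => [|N IH] F G c /= FG; first by rewrite FG.
move=> [h [ih hF hc]]; exists h; split => // t t01.
by apply: IH (hF _ t01) => s s01; apply: FG.
Qed.

Lemma cint_cst N c : cint N (fun=> c) c.
Proof.
elim: N => //= N IH; exists (cst c); split => //.
- exact: integrable01_cst.
- exact: Rintegral01_cst.
Qed.

Lemma cintZ N a F c : cint N F c -> cint N (fun s => a * F s) (a * c).
Proof.
elim: N F c => [|N IH] F c /=; first by move=> ->.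
move=> [h [ih hF <-]]; exists (fun t => a * h t); split.
- exact: (@integrableZl _ _ _ mu I01 _ a (EFin \o h)).
- by move=> t t01; apply: IH; apply: hF.
- by rewrite RintegralZl.
Qed.

Lemma cintD N F G c c' : cint N F c -> cint N G c' ->
  cint N (fun s => F s + G s) (c + c').
Proof.
elim: N F G c c' => [|N IH] F G c c' /=; first by move=> -> ->.
move=> [h [ih hF <-]] [k [ik kG <-]]; exists (fun t => h t + k t); split.
- exact: (@integrableD _ _ _ mu I01 _ (EFin \o h) (EFin \o k)).
- by move=> t t01; apply: IH; [exact: hF|exact: kG].
- by rewrite RintegralD.
Qed.

Lemma cint_sum N (J : Type) (r : seq J) (P : pred J) (F : J -> seq R -> R) (c : J -> R) :
  (forall j, P j -> cint N (F j) (c j)) ->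
  cint N (fun s => \sum_(j <- r | P j) F j s) (\sum_(j <- r | P j) c j).
Proof.
move=> FC; elim: r => [|j r IH].
  apply: (@eq_cint _ (fun=> 0)) => [s _|]; rewrite !big_nil //; exact: cint_cst.
rewrite big_cons; case: ifPn => Pj.
  apply: (@eq_cint _ (fun s => F j s + \sum_(j <- r | P j) F j s)) => [s _|].
    by rewrite big_cons Pj.
  exact: cintD (FC _ Pj) IH.
by apply: eq_cint IH => s _; rewrite big_cons (negbTE Pj).
Qed.

(** The variables are separated, so integrating one block only scales the other factor and linearity
    in each coordinate suffices. *)
Lemma cint_cat a b f g c c' : cint a f c -> cint b g c' ->
  cint (a + b) (fun s => f (take a s) * g (drop a s)) (c * c').
Proof.
move=> fc gc; elim: a f c fc => [|a IH] f c /=.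
  by move=> <-; apply: eq_cint (cintZ (f [::]) gc) => s _; rewrite take0 drop0.
move=> [h [ih hF <-]]; exists (fun t => c' * h t); split.
- exact: (@integrableZl _ _ _ mu I01 _ c' (EFin \o h)).
- move=> t t01; rewrite mulrC.
  exact: (IH (fun s => f (t :: s)) (h t) (hF _ t01)).
- by rewrite RintegralZl // mulrC.
Qed.

Lemma cint_blocks n d (psi : 'I_n -> seq R -> R) (c : 'I_n -> R) :
  (forall i, cint d (psi i) (c i)) ->
  cint (n * d) (fun s => \prod_(i < n) psi i (take d (drop (i * d) s))) (\prod_(i < n) c i).
Proof.
elim: n psi c => [|n IH] psi c H.
  by rewrite mul0n /= !big_ord0.
rewrite mulSn big_ord_recl.
have := cint_cat (H ord0) (IH _ _ (fun i => H (lift ord0 i))).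
apply: eq_cint => s _; rewrite big_ord_recl mul0n drop0; congr (_ * _).
by apply: eq_bigr => i _; rewrite drop_drop addnC -mulSn.
Qed.

Lemma cint_coords d (phi : 'I_d -> R -> R) (c : 'I_d -> R) :
  (forall k, mu.-integrable I01 (EFin \o phi k)) ->
  (forall k, Rintegral mu I01 (phi k) = c k) ->
  cint d (fun s => \prod_(k < d) phi k (nth 0 s k)) (\prod_(k < d) c k).
Proof.
elim: d phi c => [|d IH] phi c iphi cphi; first by rewrite /= !big_ord0.
rewrite big_ord_recl /=; set C := \prod_(i < d) _.
exists (fun t => C * phi ord0 t); split.
- exact: (@integrableZl _ _ _ mu I01 _ C (EFin \o phi ord0)).
- move=> t _; rewrite mulrC.
  have := cintZ (phi ord0 t) (IH (fun k => phi (lift ord0 k)) (fun k => c (lift ord0 k))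
    (fun k => iphi _) (fun k => cphi _)).
  by apply: eq_cint => s _; rewrite big_ord_recl.
- by rewrite RintegralZl // cphi mulrC.
Qed.

Definition itvf (u v t : R) : R := ((u <= t <= v)%R)%:R.

Lemma itvfE (u v : R) : itvf u v = \1_(`[u, v]%classic).
Proof. by apply/funext => t; rewrite indicE mem_setE in_itv. Qed.

Lemma integrable_itvf (u v : R) : mu.-integrable I01 (EFin \o itvf u v).
Proof.
rewrite itvfE; apply: (@integrableS _ _ _ mu setT) => //.
by apply: integrable_indic_itv.
Qed.

Lemma Rintegral_itvf (u v : R) : 0 <= u -> u <= v -> v <= 1 ->
  Rintegral mu I01 (itvf u v) = v - u.
Proof.
move=> u0 uv v1; rewrite itvfE /Rintegral integral_indic //.
rewrite setIidl; last first.
  move=> x /=; rewrite !in_itv /= => /andP[ux xv].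
  by rewrite (le_trans u0 ux) (le_trans xv v1).
transitivity (fine (mu (`[u, v]%classic : set R))); first by [].
rewrite lebesgue_measure_itv /= lte_fin.
by case: ltP => //= vu; apply/eqP; rewrite eq_sym subr_eq0 eq_le uv vu.
Qed.

Lemma poly01 (p : {poly R}) :
  mu.-integrable I01 (EFin \o (fun t => p^`().[t])) /\
  Rintegral mu I01 (fun t => p^`().[t]) = p.[1] - p.[0].
Proof.
have cp (q : {poly R}) : continuous (fun t => q.[t]) by exact: continuous_horner.
split.
  apply: continuous_compact_integrable; first exact: segment_compact.
  exact: continuous_subspaceT (cp _).
rewrite /Rintegral (@continuous_FTC2 _ _ (fun t => p.[t])) //.
- exact: continuous_subspaceT (cp _).
- split => [x _||].
  + exact: derivable_horner.
  + exact/cvg_at_right_filter/cp.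
  + exact/cvg_at_left_filter/cp.
- by move=> x _; rewrite derivE.
Qed.

End CubeIntegral.

(** * The random graph for fixed positions *)

Section ProductSpace.
Variables (R : realType) (I : finType) (w : I -> bool -> R).
Hypothesis w1 : forall i, \sum_b w i b = 1.

Lemma sum_ffun_prod (chi : I -> bool -> R) :
  \sum_(g : {ffun I -> bool}) \prod_i chi i (g i) = \prod_i \sum_b chi i b.
Proof. by rewrite bigA_distr_bigA. Qed.

(** Independence: the factors sit on distinct coordinates, and every coordinate outside the image of
    [e] sums to 1. *)
Lemma expect_prod1 (K : finType) (A : pred K) (e : K -> I) (psi : K -> bool -> R) :
  {in A &, injective e} ->
  \sum_(g : {ffun I -> bool}) (\prod_i w i (g i)) * \prod_(k | A k) psi k (g (e k))
  = \prod_(k | A k) \sum_b w (e k) b * psi k b.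
Proof.
move=> einj.
pose chi i b := \prod_(k | A k && (e k == i)) psi k b.
transitivity (\sum_(g : {ffun I -> bool}) \prod_i (w i (g i) * chi i (g i))).
  apply: eq_bigr => g _; rewrite big_split; congr (_ * _) => /=.
  rewrite (partition_big e xpredT) //=; apply: eq_bigr => i _.
  by apply: eq_bigr => k /andP[_ /eqP ->].
rewrite (sum_ffun_prod (fun i b => w i b * chi i b)).
rewrite [RHS](partition_big e xpredT) //=; apply: eq_bigr => i _.
have [k /andP[Ak /eqP eki]|none] := pickP (fun k => A k && (e k == i)).
  have Ek : (fun k' => A k' && (e k' == i)) =1 pred1 k.
    move=> k' /=; apply/idP/eqP => [/andP[Ak' /eqP ek']|->].
      by apply: einj => //; rewrite ek'.
    by rewrite Ak eki eqxx.
  rewrite (big_pred1 _ Ek) eki; apply: eq_bigr => b _.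
  by rewrite /chi (big_pred1 _ Ek).
rewrite [RHS]big_pred0 // -[RHS](w1 i); apply: eq_bigr => b _.
by rewrite /chi big_pred0 // mulr1.
Qed.

(** Conditioning on the value c k of the first coin writes each factor as a sum of products of
    one-coin functions, which reduces the claim to [expect_prod1] on the index type K + K. *)
Lemma expect_prod2 (K : finType) (A : pred K) (e1 e2 : K -> I)
    (f : K -> bool -> bool -> R) :
  {in A &, injective e1} -> {in A &, injective e2} ->
  {in A &, forall k k', e1 k != e2 k'} ->
  \sum_(g : {ffun I -> bool})
     (\prod_i w i (g i)) * \prod_(k | A k) f k (g (e1 k)) (g (e2 k))
  = \prod_(k | A k) \sum_b1 \sum_b2 w (e1 k) b1 * w (e2 k) b2 * f k b1 b2.
Proof.
move=> inj1 inj2 dis.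
pose A' (x : K + K) := match x with inl k => A k | inr k => A k end.
pose e' (x : K + K) := match x with inl k => e1 k | inr k => e2 k end.
have inj' : {in A' &, injective e'}.
  move=> [k|k] [k'|k'] Ak Ak' /= ee.
  - by congr inl; apply: inj1.
  - by move: (dis _ _ Ak Ak'); rewrite ee eqxx.
  - by move: (dis _ _ Ak' Ak); rewrite ee eqxx.
  - by congr inr; apply: inj2.
(* Outside [A] the value of [c] is forced to false, so that summing over all of [c] counts such
   indices once. *)
pose term (c : {ffun K -> bool}) k b1 b2 : R :=
  if A k then (b1 == c k)%:R * f k (c k) b2 else (c k == false)%:R.
have step1 (g : {ffun I -> bool}) :
    \prod_(k | A k) f k (g (e1 k)) (g (e2 k)) =
    \sum_(c : {ffun K -> bool}) \prod_k term c k (g (e1 k)) (g (e2 k)).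
  rewrite big_mkcond /=.
  rewrite -(bigA_distr_bigA (fun k (c : bool) =>
     if A k then (g (e1 k) == c)%:R * f k c (g (e2 k)) else (c == false)%:R)).
  apply: eq_bigr => k _; rewrite big_bool /=; case: ifP => // _; last by rewrite add0r.
  by case: (g (e1 k)); rewrite /= !mul1r !mul0r ?addr0 ?add0r.
transitivity (\sum_(c : {ffun K -> bool}) \sum_(g : {ffun I -> bool})
    (\prod_i w i (g i)) * \prod_k term c k (g (e1 k)) (g (e2 k))).
  by rewrite exchange_big /=; apply: eq_bigr => g _; rewrite step1 mulr_sumr.
pose h k (c : bool) : R :=
  if A k then w (e1 k) c * \sum_b2 w (e2 k) b2 * f k c b2 else (c == false)%:R.
transitivity (\sum_(c : {ffun K -> bool}) \prod_k h k (c k)); last first.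
  rewrite -(bigA_distr_bigA h) [RHS]big_mkcond /=; apply: eq_bigr => k _.
  rewrite /h; case: (A k); last by rewrite big_bool /= add0r.
  apply: eq_bigr => b _; rewrite mulr_sumr; apply: eq_bigr => b' _.
  by rewrite mulrA.
apply: eq_bigr => c _.
pose psi (x : K + K) b : R := match x with
  | inl k => (b == c k)%:R | inr k => f k (c k) b end.
transitivity ((\prod_(k | ~~ A k) (c k == false)%:R) *
  \sum_(g : {ffun I -> bool}) (\prod_i w i (g i)) * \prod_(x | A' x) psi x (g (e' x))).
  rewrite mulr_sumr; apply: eq_bigr => g _; rewrite mulrCA; congr (_ * _).
  rewrite (bigID A) /= mulrC; congr (_ * _).
    by apply: eq_bigr => k /negbTE Ak; rewrite /term Ak.
  rewrite big_sumType /= -big_split /=; apply: eq_bigr => k Ak.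
  by rewrite /term Ak.
rewrite expect_prod1 // big_sumType /= -big_split /= [RHS](bigID A) /= mulrC.
congr (_ * _); apply: eq_bigr => k Ak; rewrite /h ?Ak ?(negbTE Ak) //.
by congr (_ * _); rewrite big_bool /=; case: (c k); rewrite /= ?mulr1 ?mulr0 ?addr0 ?add0r.
Qed.

End ProductSpace.

(** * Independent edges and the absence of a relay *)

Section GraphModel.
Variables (R : realType) (n d : nat) (alpha beta Rr : R).
Hypothesis alpha01 : 0 < alpha <= 1.
Hypothesis beta0 : 0 <= beta.
Hypothesis Rr0 : 0 < Rr.
Implicit Types (X : 'M[R]_(n, d)) (i j k : 'I_n) (g : graph n).

Lemma dist_sym X i j : dist X i j = dist X j i.
Proof.
by rewrite /dist; congr Num.sqrt; apply: eq_bigr => k _; rewrite -sqrrN opprB.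
Qed.

Lemma dist_ge0 X i j : 0 <= dist X i j. Proof. exact: sqrtr_ge0. Qed.

Lemma edge_prob_sym X i j : edge_prob alpha beta Rr X i j = edge_prob alpha beta Rr X j i.
Proof. by rewrite /edge_prob dist_sym. Qed.

Lemma edge_prob_ge0 X i j : 0 <= edge_prob alpha beta Rr X i j.
Proof.
have /andP[a0 _] := alpha01.
rewrite /edge_prob /detect; case: ifP => // _; case: ifP => // _.
by rewrite le_min ler01 mulr_ge0 ?powR_ge0 // ltW.
Qed.

Lemma edge_prob_le1 X i j : edge_prob alpha beta Rr X i j <= 1.
Proof.
rewrite /edge_prob /detect; case: ifP => // _; case: ifP => // _.
by rewrite ge_min lexx.
Qed.

(** Within range the factor (z / Rr)^(- beta) is at least 1, so the later estimates can work with
    the constant [alpha]. *)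
Lemma edge_prob_ge X i j : dist X i j <= Rr -> alpha <= edge_prob alpha beta Rr X i j.
Proof.
have /andP[a0 a1] := alpha01.
move=> dR; rewrite /edge_prob dR /detect; case: eqVneq => [//|d0].
rewrite le_min a1 /=; rewrite -{1}[alpha]mulr1 ler_pM2l //.
have dp : 0 < dist X i j by rewrite lt_neqAle eq_sym d0 dist_ge0.
rewrite powRN invf_ge1 ?powR_gt0 ?divr_gt0 //.
have -> : 1 = powR (1 : R) beta by rewrite powR1.
apply: ge0_ler_powR; rewrite // ?nnegrE ?ler01 //.
  by rewrite divr_ge0 // ltW.
by rewrite ler_pdivrMr // mul1r.
Qed.

Definition pair_weight X (ij : 'I_n * 'I_n) (b : bool) : R :=
  if (ij.1 < ij.2)%N then
    (if b then edge_prob alpha beta Rr X ij.1 ij.2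
     else 1 - edge_prob alpha beta Rr X ij.1 ij.2)
  else (if b then 0 else 1).

Lemma graph_weightE X g :
  graph_weight alpha beta Rr X g = \prod_ij pair_weight X ij (g ij).
Proof. by []. Qed.

Lemma pair_weight_sum X ij : \sum_b pair_weight X ij b = 1.
Proof. by rewrite big_bool /pair_weight /=; case: ifP => _; ring. Qed.

Lemma pair_weight_ge0 X ij b : 0 <= pair_weight X ij b.
Proof.
rewrite /pair_weight; case: ifP => _; case: b => //; first exact: edge_prob_ge0.
by rewrite subr_ge0 edge_prob_le1.
Qed.

Lemma graph_weight_ge0 X g : 0 <= graph_weight alpha beta Rr X g.
Proof. by rewrite graph_weightE; apply: prodr_ge0 => ij _; exact: pair_weight_ge0. Qed.

Lemma graph_weight_sum X : \sum_g graph_weight alpha beta Rr X g = 1.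
Proof.
rewrite (sum_ffun_prod (pair_weight X)) big1 // => ij _; exact: pair_weight_sum.
Qed.

Lemma adj_sym g i j : adj g i j = adj g j i.
Proof. by rewrite /adj; case: ltngtP. Qed.

Lemma graph_weight_edge X g : graph_weight alpha beta Rr X g != 0 ->
  forall i j, adj g i j -> dist X i j <= Rr.
Proof.
rewrite graph_weightE => wn0.
have key i j : (i < j)%N -> g (i, j) -> dist X i j <= Rr.
  move=> ij gij; rewrite leNgt; apply/negP => dR.
  move/negP: wn0; apply; apply/eqP; rewrite (bigD1 (i, j)) //=.
  by rewrite /pair_weight /= ij gij /edge_prob leNgt dR mul0r.
move=> i j; rewrite /adj; case: ltngtP => // ij; first exact: key.
by rewrite dist_sym; exact: key.
Qed.

Definition upair i k : 'I_n * 'I_n := if (i < k)%N then (i, k) else (k, i).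

Lemma adj_upair g i k : k != i -> adj g i k = g (upair i k).
Proof.
by rewrite /adj /upair -val_eqE neq_ltn; case: (ltngtP i k).
Qed.

Lemma pair_weight_upair X i k : k != i ->
  pair_weight X (upair i k) true = edge_prob alpha beta Rr X i k.
Proof.
rewrite /upair /pair_weight -val_eqE neq_ltn; case: (ltngtP i k) => //= ik _.
  by rewrite ik.
by rewrite ik edge_prob_sym.
Qed.

(* With [b = true] only the edge to [i] is required, with [b = false] the
   vertex has to be a common neighbour of [i] and [j]. *)
Lemma prob_no_relay X i j (b : bool) (S : pred 'I_n) : i != j ->
  (forall k, S k -> dist X i k <= Rr) ->
  (forall k, S k -> ~~ b -> dist X j k <= Rr) ->
  \sum_g graph_weight alpha beta Rr X g *
     [forall k, [&& k != i, k != j & S k] ==> ~~ (adj g i k && (b || adj g j k))]%:R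
  <= \prod_(k | (k != i) && (k != j))
       (1 - (if b then alpha else alpha ^+ 2) * (S k)%:R).
Proof.
move=> ij Si Sj.
pose A k := (k != i) && (k != j).
pose f k (b1 b2 : bool) : R := 1 - (S k && b1 && (b || b2))%:R.
have inj m : m \in [:: i; j] -> {in A &, injective (upair m)}.
  move=> mij k k' _ _; rewrite /upair.
  by case: ltngtP => h; case: ltngtP => h' [] // *; subst => //; apply: val_inj => //=;
    lia.
have disj : {in A &, forall k k', upair i k != upair j k'}.
  move=> k k'; rewrite !unfold_in => /andP[ki kj] /andP[k'i k'j].
  apply/eqP; rewrite /upair; case: ifP => _; case: ifP => _ [] h1 h2; subst;
  by move: ij ki kj k'i k'j; rewrite ?eqxx.
(* The coins of the pairs {i,k} and {j,k}, for k other than i and j, are all distinct, so the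
   absence of a relay factorises over k. *)
have := expect_prod2 (pair_weight_sum X) f (inj i _) (inj j _) disj.
rewrite !inE !eqxx orbT => /(_ isT isT) E.
rewrite [leLHS](_ : _ = \sum_(g : graph n) (\prod_ij pair_weight X ij (g ij)) *
   \prod_(k | A k) f k (g (upair i k)) (g (upair j k))); last first.
  apply: eq_bigr => g _; rewrite graph_weightE; congr (_ * _).
  case: forallP => [H|H].
    rewrite big1 // => k Ak; have := H k; move: (Ak); rewrite /A => /andP[ki kj].
    rewrite ki kj /= (adj_upair g ki) (adj_upair g kj) /f.
    by case: (S k) => //=; rewrite ?subr0 // => /negbTE ->; rewrite subr0.
  move/forallP: H; rewrite negb_forall => /existsP [k].
  rewrite negb_imply negbK => /and3P[/and3P[ki kj Sk]].
  rewrite (adj_upair g ki) (adj_upair g kj) => g1 g2.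
  by rewrite (bigD1 k) /A ?ki //= /f Sk g1 g2 subrr mul0r.
rewrite E; apply: ler_prod => k /andP[ki kj].
rewrite !big_bool /= /f.
have [] := (edge_prob_ge0 X i k, edge_prob_le1 X i k).
have [] := (edge_prob_ge0 X j k, edge_prob_le1 X j k).
have := pair_weight_sum X (upair i k); have := pair_weight_sum X (upair j k).
rewrite !big_bool /= (pair_weight_upair X ki) (pair_weight_upair X kj).
set p := edge_prob _ _ _ X i k; set q := edge_prob _ _ _ X j k.
set p' := pair_weight X (upair i k) false; set q' := pair_weight X (upair j k) false.
move=> qq pp q0 q1 p0 p1.
have {pp} -> : p' = 1 - p by rewrite -pp; ring.
have {qq} -> : q' = 1 - q by rewrite -qq; ring.
have /andP[a0 a1] := alpha01.
have := Si k; have := Sj k; case: (S k) => /= [/(_ isT) h2 /(_ isT) h1|_ _]; last first.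
  by rewrite !subr0 !mulr0 !mulr1; apply/andP; split; lra.
have pa : alpha <= p by exact: edge_prob_ge.
move: h2; case: b {f E inj Sj} => /= h2.
  by rewrite !subrr !subr0 !mulr0 !mulr1; apply/andP; split; lra.
have qa : alpha <= q by exact: edge_prob_ge (h2 isT).
rewrite !subrr !subr0 !mulr0 !mulr1.
by apply/andP; split; nra.
Qed.

End GraphModel.

(** * Discretised relay bounds *)

Section Geometry.
Variables (R : realType) (d : nat).
Implicit Types (u v p q : 'I_d -> R).

Definition eucl u v : R := Num.sqrt (\sum_k (u k - v k) ^+ 2).

Lemma eucl_frob u v : eucl u v = frob (\row_k u k - \row_k v k).
Proof.
rewrite /eucl /frob big_ord1; congr Num.sqrt.
by apply: eq_bigr => k _; rewrite !mxE.
Qed.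

Lemma frob_triangle m n (A B : 'M[R]_(m, n)) : frob (A + B) <= frob A + frob B.
Proof.
have fA : dotm A A = frob A ^+ 2 by rewrite frobE sqr_sqrtr // dotm_ge0.
have fB : dotm B B = frob B ^+ 2 by rewrite frobE sqr_sqrtr // dotm_ge0.
have fA0 : 0 <= frob A by exact: sqrtr_ge0.
have fB0 : 0 <= frob B by exact: sqrtr_ge0.
rewrite -(@ler_pXn2r _ 2) ?nnegrE ?addr_ge0 //; last exact: sqrtr_ge0.
rewrite {1}frobE sqr_sqrtr ?dotm_ge0 // dotmDl !dotmDr (dotmC B A) fA fB.
have : dotm A B <= frob A * frob B by apply: dotm_CS_le; rewrite // ?fA ?fB.
by move: (frob A) (frob B) (dotm A B) => x y z; nra.
Qed.

Lemma eucl_triangle u v p : eucl u p <= eucl u v + eucl v p.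
Proof.
rewrite !eucl_frob; apply: le_trans (frob_triangle _ _).
by rewrite addrA subrK.
Qed.

Lemma euclC u v : eucl u v = eucl v u.
Proof. by congr Num.sqrt; apply: eq_bigr => k _; rewrite -sqrrN opprB. Qed.

Lemma euclxx u : eucl u u = 0.
Proof. by rewrite /eucl big1 ?sqrtr0 // => k _; rewrite subrr expr0n. Qed.

Lemma eucl_segment_l p q (t : R) : 0 <= t ->
  eucl (fun k => p k + t * (q k - p k)) p = t * eucl p q.
Proof.
move=> t0; rewrite [eucl p q]euclC /eucl -[t in RHS]ger0_norm // -sqrtr_sqr -sqrtrM ?sqr_ge0 //.
by rewrite mulr_sumr; congr Num.sqrt; apply: eq_bigr => k _; ring.
Qed.

Lemma eucl_segment_r p q (t : R) : t <= 1 ->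
  eucl (fun k => p k + t * (q k - p k)) q = (1 - t) * eucl p q.
Proof.
move=> t1; rewrite [eucl p q]euclC -(@eucl_segment_l q p) ?subr_ge0 //.
by congr eucl; apply/funext => k; ring.
Qed.

(** The constant comes from sqrt d <= sqrt 3 <= 7/4. *)
Lemma eucl_le_coord u v (s : R) : (d <= 3)%N -> 0 <= s ->
  (forall k, `|u k - v k| <= s) -> eucl u v <= 7 / 4 * s.
Proof.
move=> d3 s0 H.
have b0 : 0 <= 7 / 4 * s by lra.
rewrite -(ger0_norm b0) -sqrtr_sqr; apply: ler_wsqrtr.
apply: (@le_trans _ _ (\sum_(k < d) s ^+ 2)).
  apply: ler_sum => k _; rewrite -real_normK ?num_real //.
  by rewrite ler_pXn2r ?nnegrE.
rewrite sumr_const card_ord -[s ^+ 2 *+ d]mulr_natl.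
have : d%:R <= 3 :> R by rewrite ler_nat.
move=> d3R; have h := ler_wpM2r (sqr_ge0 s) d3R. apply: (le_trans h).
by rewrite exprMn; have := sqr_ge0 s; lra.
Qed.

End Geometry.

(** * Grid cells, search boxes and integrated relay bounds *)

Section Relay.
Variables (R : realType) (n d m : nat).
Hypothesis m0 : (0 < m)%N.
Local Notation cell := {ffun 'I_d -> 'I_m}.
Implicit Types (a c : cell) (X : 'M[R]_(n, d)) (i j k : 'I_n).

(** Closed cells cover the whole cube. A point on a common face is counted several times, which an
    upper bound tolerates and which does not change the integral. *)
Definition in_cell a (x : 'I_d -> R) : bool :=
  [forall l, (a l)%:R / m%:R <= x l <= (a l).+1%:R / m%:R].

Definition in_box (lo : 'I_d -> R) (s : R) (x : 'I_d -> R) : bool :=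
  [forall l, lo l <= x l <= lo l + s].

Lemma prod_nat_forall (P : pred 'I_d) : \prod_l ((P l)%:R : R) = [forall l, P l]%:R.
Proof.
case: forallP => [H|/forallP]; first by rewrite big1 // => l _; rewrite H.
rewrite negb_forall => /existsP [l /negbTE Pl].
by rewrite (bigD1 l) //= Pl mul0r.
Qed.

Lemma cint_in_cell a :
  cint d (fun x => (in_cell a (fun l => nth 0 x l))%:R) ((m%:R^-1 : R) ^+ d).
Proof.
have -> : (m%:R^-1 : R) ^+ d = \prod_(l < d) m%:R^-1 by rewrite prodr_const card_ord.
apply: eq_cint (@cint_coords R d (fun l => itvf ((a l)%:R / m%:R) ((a l).+1%:R / m%:R)) _ _ _).
- by move=> x _; rewrite -prod_nat_forall.
- by move=> l; exact: integrable_itvf.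
have mp : 0 < (m%:R : R) by rewrite ltr0n.
move=> l; rewrite Rintegral_itvf.
- by rewrite -mulrBl -natrB // subSnn mul1r.
- by rewrite divr_ge0 // ler0n.
- by rewrite ler_pM2r ?invr_gt0 // ler_nat.
- by rewrite ler_pdivrMr // mul1r ler_nat.
Qed.

Lemma cint_in_box lo (s : R) : 0 <= s -> (forall l, 0 <= lo l /\ lo l + s <= 1) ->
  cint d (fun x => (in_box lo s (fun l => nth 0 x l))%:R) (s ^+ d).
Proof.
move=> s0 Hlo.
have -> : s ^+ d = \prod_(l < d) s by rewrite prodr_const card_ord.
apply: eq_cint (@cint_coords R d (fun l => itvf (lo l) (lo l + s)) _ _ _).
- by move=> x _; rewrite -prod_nat_forall.
- by move=> l; exact: integrable_itvf.
move=> l; have [l0 l1] := Hlo l; rewrite Rintegral_itvf ?lerDl //.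
by rewrite addrC addKr.
Qed.

(* Restricting [x_i] and [x_j] to cells makes the bound a finite sum of products
   of functions of single nodes, so it is integrated without Fubini. *)
Definition relay_bound (q s : R) (lo : cell -> cell -> 'I_d -> R) i j X : R :=
  \sum_a \sum_c (in_cell a (X i))%:R * (in_cell c (X j))%:R *
    \prod_(k | (k != i) && (k != j)) (1 - q * (in_box (lo a c) s (X k))%:R).

Lemma posX_block (s : seq R) (i : 'I_n) :
  posX n d s i = (fun l : 'I_d => nth 0 (take d (drop (i * d) s)) l).
Proof. by apply/funext => l; rewrite mxE nth_take // nth_drop. Qed.

(** Each pair of cells contributes its volume m^(-2d) times the same power, and there are m^(2d)
    pairs. *)
Lemma cint_relay_bound (q s : R) lo i j : i != j -> 0 <= s ->
  (forall a c l, 0 <= lo a c l /\ lo a c l + s <= 1) ->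
  cint (n * d) (fun x => relay_bound q s lo i j (posX n d x))
    ((1 - q * s ^+ d) ^+ (n - 2)).
Proof.
move=> ij s0 Hlo.
pose psi a c k (x : seq R) : R :=
  if k == i then (in_cell a (fun l => nth 0 x l))%:R
  else if k == j then (in_cell c (fun l => nth 0 x l))%:R
  else 1 - q * (in_box (lo a c) s (fun l => nth 0 x l))%:R.
pose M : R := m%:R^-1 ^+ d.
pose C k : R := if k == i then M else if k == j then M else 1 - q * s ^+ d.
have split2 (F : 'I_n -> R) :
    \prod_k F k = F i * F j * \prod_(k | (k != i) && (k != j)) F k.
  by rewrite (bigD1 i) //= (bigD1 j) ?mulrA // eq_sym.
have -> : (1 - q * s ^+ d) ^+ (n - 2) = \sum_(a : cell) \sum_(c : cell) \prod_k C k.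
  rewrite !sumr_const card_ffun !card_ord split2 {1 2}/C !eqxx eq_sym (negbTE ij).
  rewrite (eq_bigr (fun=> 1 - q * s ^+ d)); last first.
    by move=> k /andP[/negbTE ki /negbTE kj]; rewrite /C ki kj.
  rewrite prodr_const.
  have -> : #|(fun k : 'I_n => (k != i) && (k != j))| = (n - 2)%N.
    transitivity #|predC (pred2 i j)|.
      by apply: eq_card => k; rewrite !inE negb_or.
    by have := cardC (pred2 i j); rewrite card2 ij card_ord /=;
      move=> /(congr1 (subn^~ 2)); rewrite addKn.
  rewrite -[in RHS]mulrnA -[RHS]mulr_natl mulrA natrM natrX /M.
  have mM : (m%:R : R) ^+ d * m%:R^-1 ^+ d = 1.
    by rewrite -exprMn divff ?expr1n // pnatr_eq0 -lt0n.
  have -> : (m%:R : R) ^+ d * m%:R ^+ d * (m%:R^-1 ^+ d * m%:R^-1 ^+ d) = 1.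
    by rewrite mulrACA mM mulr1.
  by rewrite mul1r.
apply: cint_sum => a _; apply: cint_sum => c _.
apply: eq_cint (@cint_blocks R n d (psi a c) C _).
  move=> x _; rewrite split2 /psi !eqxx eq_sym (negbTE ij) !posX_block; congr (_ * _).
  by apply: eq_bigr => k /andP[/negbTE ki /negbTE kj]; rewrite ki kj posX_block.
move=> k; rewrite /psi /C; case: ifP => _; first exact: cint_in_cell.
case: ifP => _; first exact: cint_in_cell.
have := cintD (cint_cst d 1) (cintZ (- q) (cint_in_box s0 (Hlo a c))).
rewrite mulNr; apply: eq_cint => x _; by rewrite mulNr.
Qed.

Lemma in_cell_ex (x : 'I_d -> R) : (forall l, 0 <= x l <= 1) -> exists a, in_cell a x.
Proof.
move=> x01.
have mp : 0 < (m%:R : R) by rewrite ltr0n.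
have H l : exists k : 'I_m, k%:R / m%:R <= x l <= k.+1%:R / m%:R.
  have /andP[x0 x1] := x01 l.
  (* The truncation of m x would be m at x = 1, which is not an index; the last cell is used
     instead. *)
  have [x1e|xlt] := eqVneq (x l) 1.
    have pm : (m.-1 < m)%N by rewrite prednK.
    exists (Ordinal pm) => /=; rewrite x1e prednK // divff ?lexx ?andbT ?gt_eqF //.
    by rewrite ler_pdivrMr // mul1r ler_nat leq_pred.
  have y0 : 0 <= x l * m%:R by rewrite mulr_ge0 // ltW.
  have tm : (Num.truncn (x l * m%:R) < m)%N.
    rewrite truncn_lt_nat // -[ltRHS]mul1r ltr_pM2r //.
    by rewrite lt_neqAle xlt.
  exists (Ordinal tm) => /=; rewrite ler_pdivrMr // ler_pdivlMr //.
  by have /andP[-> /ltW ->] := truncn_itv y0.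
exists [ffun l => xchoose (H l)]; apply/forallP => l; rewrite ffunE.
exact: (xchooseP (H l)).
Qed.

Lemma in_cell_dist a x : (d <= 3)%N -> in_cell a x ->
  eucl x (fun l => (a l)%:R / m%:R) <= 7 / 4 * m%:R^-1.
Proof.
move=> d3 /forallP ax; apply: eucl_le_coord => // l.
have /andP[h1 h2] := ax l.
rewrite ger0_norm ?subr_ge0 // lerBlDr (le_trans h2) //.
by rewrite -natr1 mulrDl addrC mul1r.
Qed.

Variables (alpha beta Rr : R).
Hypothesis alpha01 : 0 < alpha <= 1.
Hypothesis beta0 : 0 <= beta.
Hypothesis Rr0 : 0 < Rr.

(** The bad events contain a condition on the positions, such as x_i and x_j being far apart. It is
    available to the geometric hypothesis through the existence of a bad graph; if there is none,
    the left side is 0. Otherwise the summand of one pair of cells containing x_i and x_j already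
    suffices. *)
Lemma prob_fail_le X i j (b : bool) (s : R) lo (Bad : graph n -> bool) : i != j ->
  (forall k l, 0 <= X k l <= 1) ->
  (forall a c, in_cell a (X i) -> in_cell c (X j) -> (exists g, Bad g) ->
     forall k, in_box (lo a c) s (X k) ->
     [/\ dist X i k <= Rr, ~~ b -> dist X j k <= Rr &
        forall g, k != i -> k != j -> adj g i k && (b || adj g j k) -> ~~ Bad g]) ->
  \sum_g graph_weight alpha beta Rr X g * (Bad g)%:R
  <= relay_bound (if b then alpha else alpha ^+ 2) s lo i j X.
Proof.
move=> ij X01 H; set q := if b then _ else _.
have /andP[a0 a1] := alpha01.
have q01 : 0 <= q <= 1.
  rewrite /q; case: (b); first by rewrite ltW.
  by rewrite sqr_ge0 expr_le1 // ltW.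
have f0 (lo' : 'I_d -> R) k : 0 <= 1 - q * (in_box lo' s (X k))%:R.
  by case/andP: q01 => q0 q1; case: (in_box _ _ _); rewrite ?mulr1 ?mulr0; lra.
pose T a c := (in_cell a (X i))%:R * (in_cell c (X j))%:R *
    \prod_(k | (k != i) && (k != j)) (1 - q * (in_box (lo a c) s (X k))%:R).
have T0 a c : 0 <= T a c.
  by rewrite mulr_ge0 // ?mulr_ge0 ?ler0n //; apply: prodr_ge0.
rewrite -[leRHS]/(\sum_a \sum_c T a c).
have [[g0 Bg0]|none] := pselect (exists g, Bad g); last first.
  rewrite big1; first by apply: sumr_ge0 => a _; apply: sumr_ge0.
  move=> g _; case E : (Bad g); rewrite ?mulr0 //.
  by case: none; exists g.
have [a ai] := in_cell_ex (X01 i); have [c cj] := in_cell_ex (X01 j).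
have Hk := H a c ai cj (ex_intro _ g0 Bg0).
have Tle : T a c <= \sum_a \sum_c T a c.
  rewrite (bigD1 a) //= (bigD1 c) //= -addrA lerDl.
  by apply: addr_ge0; apply: sumr_ge0 => // a' _; apply: sumr_ge0.
apply: le_trans Tle; rewrite /T ai cj !mul1r.
apply: le_trans (@prob_no_relay R n d alpha beta Rr alpha01 beta0 Rr0 X i j b
  (fun k => in_box (lo a c) s (X k)) ij _ _); first last.
- by move=> k /Hk[].
- by move=> k /Hk[].
apply: ler_sum => g _; apply: ler_wpM2l; first exact: graph_weight_ge0.
rewrite ler_nat; case Bg : (Bad g) => //=; rewrite lt0b.
apply/forallP => k; apply/implyP => /and3P[ki kj /Hk[_ _ /(_ g ki kj) nb]].
by apply/negP => /nb; rewrite Bg.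
Qed.

(* An interval of length [s] inside [[0,1]] all of whose points are within [s]
   of the (clamped) coordinate of the point at parameter [tau] of the segment
   joining the corners of the two cells. *)
Definition box_corner (tau : cell -> cell -> R) (s : R) a c (l : 'I_d) : R :=
  let y := (a l)%:R / m%:R + tau a c * ((c l)%:R / m%:R - (a l)%:R / m%:R) in
  let z := Num.max 0 (Num.min 1 y) in
  if z + s <= 1 then z else z - s.

(** Thanks to the clamp this covers all pairs of cells, as [cint_relay_bound] demands, whereas
    [far_tau] lies in [0,1] only for pairs far enough apart. *)
Lemma box_corner_itv (tau : cell -> cell -> R) (s : R) a c l : 0 <= s <= 1 / 2 ->
  0 <= box_corner tau s a c l /\ box_corner tau s a c l + s <= 1.
Proof.
rewrite /box_corner; set z := Num.max _ _ => /andP[s0 s1].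
have z0 : 0 <= z by rewrite le_max lexx.
have z1 : z <= 1 by rewrite ge_max ler01 ge_min lexx.
by case: ifPn => [|]; rewrite -?ltNge => h; split; lra.
Qed.

Lemma cell_dist a c x y : (d <= 3)%N -> in_cell a x -> in_cell c y ->
  eucl (fun l => (a l)%:R / m%:R) (fun l => (c l)%:R / m%:R) - 2 * (7 / 4 * m%:R^-1)
    <= eucl x y <=
  eucl (fun l => (a l)%:R / m%:R) (fun l => (c l)%:R / m%:R) + 2 * (7 / 4 * m%:R^-1).
Proof.
move=> d3 ax cy; set L := eucl (fun l => _ / _) _; set eta := 7 / 4 * _.
set p := (fun l => (a l)%:R / m%:R) in L *.
set q := (fun l => (c l)%:R / m%:R) in L *.
have px : eucl x p <= eta by exact: in_cell_dist.
have qy : eucl y q <= eta by exact: in_cell_dist.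
have T := @eucl_triangle R d.
have C := @euclC R d.
apply/andP; split.
- by have := T p x q; have := T x y q; rewrite [eucl p x]C -/L; lra.
- by have := T x p y; have := T p q y; rewrite [eucl q y]C -/L; lra.
Qed.

Lemma box_dist (tau : cell -> cell -> R) (s : R) a c x y z :
  (d <= 3)%N -> 0 <= s -> 0 <= tau a c <= 1 ->
  let eta := 7 / 4 * m%:R^-1 in
  let rho := 7 / 4 * s in
  let L := eucl (fun l => (a l)%:R / m%:R) (fun l => (c l)%:R / m%:R) in
  in_cell a x -> in_cell c y -> in_box (box_corner tau s a c) s z ->
  eucl x z <= tau a c * L + eta + rho /\
  eucl y z <= (1 - tau a c) * L + eta + rho.
Proof.
move=> d3 s0 /andP[t0 t1] eta rho L ax cy bz.
set p := (fun l => (a l)%:R / m%:R) in L *.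
set q := (fun l => (c l)%:R / m%:R) in L *.
set t := tau a c in t0 t1 *.
pose w l := p l + t * (q l - p l).
have mp : 0 < (m%:R : R) by rewrite ltr0n.
have pq (b : cell) l : 0 <= ((b l)%:R / m%:R : R) <= 1.
  by rewrite divr_ge0 ?ler0n //= ler_pdivrMr // mul1r ler_nat ltnW.
have w01 l : 0 <= w l <= 1.
  rewrite /w /p /q; have := pq a l; have := pq c l.
  by move=> /andP[? ?] /andP[? ?]; apply/andP; split; nra.
have wz : eucl w z <= rho.
  apply: eucl_le_coord => // l.
  have := forallP bz l; rewrite /box_corner -/t.
  have -> : Num.max 0 (Num.min 1 ((a l)%:R / m%:R + t * ((c l)%:R / m%:R - (a l)%:R / m%:R))) = w l.
    have /andP[w0 w1] := w01 l.
    by rewrite -/(w l) min_r // max_r.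
  by rewrite ler_norml; case: ifP => _ /andP[h1 h2]; apply/andP; split; lra.
have px : eucl x p <= eta by exact: in_cell_dist.
have qy : eucl y q <= eta by exact: in_cell_dist.
have pw : eucl w p = t * L by exact: eucl_segment_l.
have qw : eucl w q = (1 - t) * L by exact: eucl_segment_r.
have T := @eucl_triangle R d.
have C := @euclC R d.
split.
- by have := T x p z; have := T p w z; rewrite [eucl p w]C; lra.
- by have := T y q z; have := T q w z; rewrite [eucl q w]C; lra.
Qed.

End Relay.

(** * Hop counts *)

Section Hops.
Variables (R : realType) (n : nat) (g : graph n).
Implicit Types (i j k : 'I_n) (K : nat).

Lemma ball_kS i K y : (y \in ball_k g i K.+1) =
  (y \in ball_k g i K) || [exists x in ball_k g i K, adj g x y].
Proof. by rewrite /ball_k iterS -/(ball_k g i K) !inE. Qed.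

Lemma ball_kW i K y : y \in ball_k g i K -> y \in ball_k g i K.+1.
Proof. by rewrite ball_kS => ->. Qed.

Lemma ball_k_step i K x y : x \in ball_k g i K -> adj g x y -> y \in ball_k g i K.+1.
Proof. by move=> xB xy; rewrite ball_kS; apply/orP; right; apply/existsP; exists x; rewrite xB. Qed.

(** Balls grow by appending an edge at the far end, while greedy routing and symmetry add one at the
    start. *)
Lemma ball_k_prepend i k K y : adj g i k -> y \in ball_k g k K -> y \in ball_k g i K.+1.
Proof.
move=> ik; elim: K y => [|K IH] y.
  rewrite /ball_k /= inE => /eqP ->.
  by apply: (@ball_k_step i 0 i) => //; rewrite /ball_k /= inE.
rewrite ball_kS => /orP[/IH/ball_kW //|/existsP[x /andP[/IH xB xy]]].
exact: ball_k_step xB xy.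
Qed.

Lemma ball_k_sym i K j : j \in ball_k g i K -> i \in ball_k g j K.
Proof.
elim: K i j => [|K IH] i j; first by rewrite /ball_k /= !inE eq_sym.
rewrite ball_kS => /orP[/IH/ball_kW //|/existsP[x /andP[/IH xB xj]]].
by apply: ball_k_prepend xB; rewrite adj_sym.
Qed.

Lemma hop_sym i j : hop g i j = hop g j i.
Proof.
rewrite /hop; apply: eq_find => K.
by apply/idP/idP; exact: ball_k_sym.
Qed.

Lemma hop_le i j K : (K < n)%N -> j \in ball_k g i K -> (hop g i j <= K)%N.
Proof.
move=> Kn jB; rewrite leqNgt; apply/negP => /(before_find 0%N).
by rewrite nth_iota // add0n jB.
Qed.

Lemma hop_mem i j : (hop g i j < n)%N -> j \in ball_k g i (hop g i j).
Proof.
move=> hn; have : has (fun K => j \in ball_k g i K) (iota 0 n).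
  by rewrite has_find size_iota.
by move=> /(nth_find 0%N); rewrite nth_iota // add0n.
Qed.

Variables (d : nat) (X : 'M[R]_(n, d)) (Rr step : R).
Hypothesis edge_len : forall i j, adj g i j -> dist X i j <= Rr.

Lemma dist_triangle i j k : dist X i k <= dist X i j + dist X j k.
Proof. exact: (eucl_triangle (X i) (X j) (X k)). Qed.

Lemma ball_k_dist i K j : 0 <= Rr -> j \in ball_k g i K -> dist X i j <= Rr * K%:R.
Proof.
move=> R0; elim: K j => [|K IH] j.
  rewrite /ball_k /= inE => /eqP ->; rewrite mulr0 le_eqVlt; apply/orP; left.
  by apply/eqP; exact: (euclxx (X i)).
have -> : Rr * K.+1%:R = Rr * K%:R + Rr by rewrite -natr1; ring.
rewrite ball_kS => /orP[/IH h|/existsP[x /andP[/IH h /edge_len xj]]]; first by lra.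
by have := dist_triangle i x j; lra.
Qed.

Hypothesis step0 : 0 <= step.
Hypothesis far : forall i j, i != j -> Rr < dist X i j ->
  exists2 k, adj g i k & dist X k j <= dist X i j - step.
Hypothesis near2 : forall i j, i != j -> dist X i j <= Rr ->
  exists2 k, adj g i k & adj g j k.

(** At most [K] greedy steps bring the walk within [Rr] of j. A pair in range need not be adjacent,
    so the walk ends with two hops through a common neighbour. *)
Lemma ball_k_greedy K i j : dist X i j <= Rr + K%:R * step -> j \in ball_k g i K.+2.
Proof.
elim: K i j => [|K IH] i j.
  rewrite mul0r addr0 => dR; have [->|ij] := eqVneq i j.
    by do 2! apply: ball_kW; rewrite /ball_k /= inE.
  have [k ik jk] := near2 ij dR; apply: ball_k_prepend ik _.
  by apply: (@ball_k_step k 0 k); rewrite 1?adj_sym // /ball_k /= inE.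
move=> dK; have [dR|dR] := leP (dist X i j) Rr.
  apply: ball_kW; apply: IH; apply: (le_trans dR); rewrite lerDl mulr_ge0 //.
have [ij|ij] := eqVneq i j.
  by rewrite ij; elim: (K.+3) => [|K' IH']; [rewrite /ball_k /= inE|exact: ball_kW].
have [k ik dk] := far ij dR; apply: ball_k_prepend ik _; apply: IH.
have -> : K%:R * step = K.+1%:R * step - step by rewrite -natr1; ring.
by lra.
Qed.

(** The upper bound on the distance keeps the walk shorter than n, as [hop] inspects only radii
    below n and returns n otherwise. *)
Lemma hop_bounds i j : 0 < step <= Rr -> dist X i j < Rr + (n%:R - 3) * step ->
  (2 < n)%N ->
  (hop g i j < n)%N /\
  (dist X i j <= Rr * (hop g i j)%:R <= dist X i j * (Rr / step) + 2 * Rr).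
Proof.
move=> /andP[s0 sR] dn n2; have R0 : 0 <= Rr by lra.
have [K [Kn dK Kle]] : exists K, [/\ (K.+2 < n)%N, dist X i j <= Rr + K%:R * step &
    Rr * K.+2%:R <= dist X i j * (Rr / step) + 2 * Rr].
  have Rs : 1 <= Rr / step by rewrite ler_pdivlMr // mul1r.
  have d0 := dist_ge0 X i j.
  have [dR|dR] := leP (dist X i j) Rr.
    exists 0%N; split => //; first by rewrite mul0r addr0.
    by rewrite mulrC lerDr mulr_ge0 // (le_trans ler01).
  pose t := (dist X i j - Rr) / step.
  have t0 : 0 <= t by rewrite divr_ge0 ?subr_ge0 ?ltW.
  have ts : t * step = dist X i j - Rr by rewrite divfK // gt_eqF.
  have /andP[h1 h2] := truncn_itv t0; set K := Num.truncn t in h1 h2.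
  (* Covering the excess over [Rr] takes at most truncn t + 1 greedy steps, hence truncn t + 3 hops;
     one of the three extra terms [Rr] is absorbed by Rr (Rr / step) >= Rr. *)
  exists K.+1; split.
  - have : K%:R < n%:R - 3 :> R.
      by apply: (le_lt_trans h1); rewrite ltr_pdivrMr //; lra.
    by rewrite ltrBrDr -natrD ltr_nat addn3.
  - have : t * step <= K.+1%:R * step by rewrite ler_pM2r // ltW.
    by lra.
  - have -> : K.+3%:R = K%:R + 3 :> R by rewrite -natrD addn3.
    have tR : t * Rr = dist X i j * (Rr / step) - Rr * (Rr / step).
      by rewrite /t; ring.
    have : K%:R * Rr <= t * Rr by rewrite ler_wpM2r.
    have : Rr <= Rr * (Rr / step) by rewrite ler_peMr.
    by rewrite tR; lra.
have jB := ball_k_greedy dK.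
have hK : (hop g i j <= K.+2)%N by exact: hop_le.
have hn : (hop g i j < n)%N by exact: leq_ltn_trans Kn.
split => //; rewrite (ball_k_dist R0 (hop_mem hn)) /=.
by apply: le_trans Kle; rewrite ler_wpM2l // ler_nat.
Qed.

End Hops.

(** * Centred configurations *)

Section Centering.
Variables (R : realType) (n : nat).
Hypothesis n0 : (0 < n)%N.
Local Notation L := (Lmat R n).

Let nR0 : (n%:R : R) != 0. Proof. by rewrite pnatr_eq0 -lt0n. Qed.

Lemma Lmat_tr : L^T = L.
Proof. by rewrite /Lmat linearB /= linearZ /= trmx1 trmx_const. Qed.

Lemma Lmat_const p : L *m const_mx 1 = 0 :> 'M[R]_(n, p).
Proof.
rewrite /Lmat mulmxBl mul1mx -scalemxAl; apply/matrixP => i j; rewrite !mxE.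
under eq_bigr do rewrite !mxE mulr1.
by rewrite sumr_const card_ord mulVf // subrr.
Qed.

Lemma Lmat_idem : L *m L = L.
Proof. by rewrite {2}/Lmat mulmxBr mulmx1 -scalemxAr Lmat_const scaler0 subr0. Qed.

Lemma dotm_Lmat_le p (A : 'M[R]_(n, p)) : dotm (L *m A) (L *m A) <= dotm A A.
Proof.
have h : dotm (L *m A) (A - L *m A) = 0.
  by rewrite dotm_mull Lmat_tr mulmxBr mulmxA Lmat_idem subrr dotm0r.
have -> : dotm A A = dotm (L *m A) (L *m A) + dotm (A - L *m A) (A - L *m A).
  have -> : dotm A A = dotm (L *m A + (A - L *m A)) (L *m A + (A - L *m A)).
    by rewrite addrC subrK.
  move: h; move: (L *m A) (A - L *m A) => u v h.
  by rewrite dotmDl !dotmDr [dotm v u]dotmC h addr0 add0r.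
by rewrite lerDl dotm_ge0.
Qed.

Lemma dotm_Lmat2_le (A : 'M[R]_n) : dotm (L *m A *m L) (L *m A *m L) <= dotm A A.
Proof.
rewrite -[L *m A *m L]trmxK dotm_tr 2!trmx_mul Lmat_tr.
apply: le_trans (dotm_Lmat_le _) _; rewrite -{1 2}Lmat_tr -trmx_mul dotm_tr.
exact: dotm_Lmat_le.
Qed.

Variables (d : nat) (X : 'M[R]_(n, d)).

Definition Dmat : 'M[R]_n := \matrix_(i, j) dist X i j ^+ 2.

(** Expanding |x_i - x_j|^2, the two terms that depend on i or on j alone have constant rows or
    columns and are killed by centring. *)
Lemma Lmat_Dmat : L *m Dmat *m L = - 2 *: (L *m X *m (L *m X)^T).
Proof.
pose a : 'cV[R]_n := \col_i \sum_k X i k ^+ 2.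
have -> : Dmat = a *m const_mx 1 + const_mx 1 *m a^T - 2 *: (X *m X^T).
  apply/matrixP => i j; rewrite !mxE !big_ord1 !mxE.
  rewrite sqr_sqrtr; last by apply: sumr_ge0 => k _; exact: sqr_ge0.
  rewrite mulr1 mul1r mulr_sumr -sumrN -!big_split /=.
  by apply: eq_bigr => k _; rewrite !mxE; ring.
have cL : const_mx 1 *m L = 0 :> 'M[R]_(1, n).
  by apply: trmx_inj; rewrite trmx_mul Lmat_tr trmx_const Lmat_const trmx0.
move: (Lmat_const 1) (Lmat_tr) cL; move: (Lmat R n) => K Kc Kt cK.
have e1 : K *m (a *m const_mx 1) *m K = 0 by rewrite -!mulmxA cK !mulmx0.
have e2 : K *m (const_mx 1 *m a^T) *m K = 0 by rewrite mulmxA Kc !mul0mx.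
rewrite mulmxBr mulmxBl mulmxDr mulmxDl e1 e2 addr0 sub0r.
by rewrite -scalemxAr -scalemxAl trmx_mul Kt !mulmxA -scaleNr.
Qed.

(** This and [cmom] are centred at 1/2, the true mean of a coordinate, and not at the empirical
    mean, so that they average independent terms; [gram_Lmat] makes up for the difference. *)
Definition cmean (k : 'I_d) : R := n%:R^-1 * \sum_i (X i k - 1 / 2).
Definition cmom (k l : 'I_d) : R :=
  n%:R^-1 * \sum_i (X i k - 1 / 2) * (X i l - 1 / 2).

Lemma LmatE i k : (L *m X) i k = X i k - 1 / 2 - cmean k.
Proof.
rewrite /Lmat mulmxBl mul1mx -scalemxAl !mxE /cmean.
under eq_bigr do rewrite mxE mul1r.
have -> : \sum_i (X i k - 1 / 2) = \sum_i X i k - n%:R * (1 / 2).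
  by rewrite sumrB sumr_const card_ord -[(1 / 2) *+ n]mulr_natl.
by rewrite mulrBr [n%:R^-1 * (n%:R * _)]mulrA mulVf //; ring.
Qed.

Lemma gram_Lmat k l :
  ((L *m X)^T *m (L *m X)) k l = n%:R * (cmom k l - cmean k * cmean l).
Proof.
rewrite mxE.
under eq_bigr do rewrite mxE !LmatE.
have s1 k' : \sum_i (X i k' - 1 / 2) = n%:R * cmean k'.
  by rewrite /cmean mulrA mulfV // [RHS]mul1r.
have s2 : \sum_i (X i k - 1 / 2) * (X i l - 1 / 2) = n%:R * cmom k l.
  by rewrite /cmom mulrA mulfV // [RHS]mul1r.
move: (s1 k) (s1 l); move: (cmean k) (cmean l) => x y sx sy.
have e i : (X i k - 1 / 2 - x) * (X i l - 1 / 2 - y) =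
   (X i k - 1 / 2) * (X i l - 1 / 2) - y * (X i k - 1 / 2)
   - x * (X i l - 1 / 2) + x * y by ring.
rewrite (eq_bigr _ (fun i _ => e i)) big_split /= !sumrB -[\sum_i y * _]mulr_sumr.
rewrite -[\sum_i x * (_ - _)]mulr_sumr sumr_const card_ord.
by rewrite sx sy s2 -[(x * y) *+ n]mulr_natl; ring.
Qed.

Hypothesis d3 : (d <= 3)%N.
Let eps : R := 1 / 12 * (1 / 100).
Hypothesis mean_small : forall k, `|cmean k| <= eps.
Hypothesis mom_small : forall k l, `|cmom k l - (k == l)%:R / 12| <= eps.

(** Each entry of the Gram matrix divided by n is within 2 eps of that of I/12, one eps for [cmom]
    and one for the product of means. This lowers the form by at most 2 d eps |c|^2, and 1/12 -
    6/1200 >= 1/13. *)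
Lemma gram_lower (c : 'rV[R]_d) :
  n%:R * (1 / 13) * dotm c c <= dotm c (c *m ((L *m X)^T *m (L *m X))).
Proof.
have d3R : (d%:R : R) <= 3 by rewrite ler_nat.
have -> : dotm c (c *m ((L *m X)^T *m (L *m X))) =
    n%:R * \sum_k \sum_l c 0 k * c 0 l * (cmom l k - cmean l * cmean k).
  rewrite dotmE big_ord1 mulr_sumr; apply: eq_bigr => k _.
  rewrite [(c *m _) _ _]mxE !mulr_sumr; apply: eq_bigr => l _.
  by rewrite gram_Lmat; ring.
rewrite -mulrA ler_wpM2l ?ler0n //.
rewrite dotmE big_ord1; set N := \sum_k _ * _.
have key k l : c 0 k * c 0 l * (cmom l k - cmean l * cmean k) >=
    c 0 k * c 0 l * ((l == k)%:R / 12) - eps * (c 0 k * c 0 k + c 0 l * c 0 l).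
  have xy : `|cmean l * cmean k| <= eps.
    rewrite normrM; apply: le_trans (ler_pM _ _ (mean_small l) (mean_small k)) _ => //.
    by rewrite /eps; lra.
  have := mom_small l k; move: xy; rewrite !ler_norml; set u := _ / 12.
  set p := cmom l k; set w := cmean l * cmean k.
  move: (c 0 k) (c 0 l) => a b /andP[w1 w2] /andP[p1 p2].
  have h1 : 0 <= 2 * eps - (p - u - w) by lra.
  have h2 : 0 <= 2 * eps + (p - u - w) by lra.
  (* The sum of the two products is 4 times the claim, by polarisation of a b. *)
  have := mulr_ge0 h1 (sqr_ge0 (a - b)); have := mulr_ge0 h2 (sqr_ge0 (a + b)).
  by move: (eps) => E; lra.
apply: (@le_trans _ _ (\sum_k \sum_l (c 0 k * c 0 l * ((l == k)%:R / 12)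
   - eps * (c 0 k * c 0 k + c 0 l * c 0 l)))); last first.
  by apply: ler_sum => k _; apply: ler_sum => l _; exact: key.
have -> : \sum_k \sum_l (c 0 k * c 0 l * ((l == k)%:R / 12)
   - eps * (c 0 k * c 0 k + c 0 l * c 0 l)) = N / 12 - eps * (2 * d%:R * N).
  transitivity (\sum_k (c 0 k * c 0 k / 12 - eps * (d%:R * (c 0 k * c 0 k) + N))).
    apply: eq_bigr => k _; rewrite sumrB; congr (_ - _).
      rewrite (bigD1 k) //= eqxx mulr1n mul1r big1 ?addr0 //.
      by move=> l /negbTE ->; rewrite mul0r mulr0.
    by rewrite -mulr_sumr big_split /= sumr_const card_ord -[(c 0 k * c 0 k) *+ d]mulr_natl.
  rewrite sumrB -mulr_suml -mulr_sumr big_split /= -mulr_sumr sumr_const card_ord -/N.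
  by rewrite -[N *+ d]mulr_natl; ring.
have N0 : 0 <= N by apply: sumr_ge0 => k _; rewrite -expr2 sqr_ge0.
have : d%:R * N <= 3 * N by rewrite ler_wpM2r.
by rewrite /eps; lra.
Qed.

(** The trace has at most three diagonal entries, each at most n (1/12 + 1/1200). *)
Lemma dotm_LX_le : dotm (L *m X) (L *m X) <= n%:R * (253 / 1000).
Proof.
have d3R : (d%:R : R) <= 3 by rewrite ler_nat.
rewrite /dotm /mxtrace.
apply: (@le_trans _ _ (\sum_(k < d) n%:R * (1 / 12 + eps))).
  apply: ler_sum => k _; rewrite gram_Lmat ler_wpM2l ?ler0n //.
  have := mom_small k k; rewrite eqxx mulr1n ler_norml => /andP[_ h].
  by have := sqr_ge0 (cmean k); rewrite expr2; lra.
rewrite sumr_const card_ord -[_ *+ d]mulr_natl mulrCA ler_wpM2l ?ler0n //.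
by rewrite /eps; lra.
Qed.

Lemma sum_dist_le : \sum_i \sum_j dist X i j ^+ 2 <= 2 * n%:R * dotm (L *m X) (L *m X).
Proof.
set Y := L *m X.
have e i j : dist X i j ^+ 2 = \sum_k (Y i k - Y j k) ^+ 2.
  rewrite sqr_sqrtr; last by apply: sumr_ge0 => k _; exact: sqr_ge0.
  by apply: eq_bigr => k _; rewrite !LmatE; congr (_ ^+ 2); ring.
have -> : \sum_i \sum_j dist X i j ^+ 2 = \sum_k \sum_i \sum_j (Y i k - Y j k) ^+ 2.
  rewrite [RHS]exchange_big /=; apply: eq_bigr => i _; rewrite [RHS]exchange_big /=.
  by apply: eq_bigr => j _; rewrite e.
rewrite dotmE [X in _ * X]exchange_big /= mulr_sumr; apply: ler_sum => k _.
set S := \sum_i Y i k * Y i k; set T := \sum_i Y i k.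
have -> : \sum_i \sum_j (Y i k - Y j k) ^+ 2 = 2 * n%:R * S - 2 * T * T.
  transitivity (\sum_i (n%:R * (Y i k * Y i k) - 2 * T * Y i k + S)).
    apply: eq_bigr => i _.
    transitivity (\sum_j (Y i k * Y i k - 2 * Y i k * Y j k + Y j k * Y j k)).
      by apply: eq_bigr => j _; ring.
    rewrite big_split sumrB /= -!mulr_sumr -/T -/S sumr_const card_ord -[Y i k *+ n]mulr_natl.
    by ring.
  rewrite big_split sumrB /= -!mulr_sumr -/T -/S sumr_const card_ord -[S *+ n]mulr_natl.
  by ring.
by have := sqr_ge0 T; rewrite expr2; lra.
Qed.

End Centering.

(** * The error bound for a good graph and good positions *)

Section Deterministic.
Variable R : realType.

(** All terms of higher order are made linear in r and [Rr] by means of D <= 7/4, r <= 21/100 and Rr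
    <= 21/2000. The terms with a factor D go into the first summand, and the remaining 4 Rr^2 into x
    / 400. *)
Lemma hop_sq_err (D h r Rr x kappa : R) : 0 <= D <= 7 / 4 ->
  D <= h <= D * kappa + 2 * Rr -> kappa * (1 - 9 / 80 * r) = 1 ->
  0 <= r -> 0 < Rr -> x = r + 20 * Rr -> x <= 21 / 100 ->
  0 <= h ^+ 2 - D ^+ 2 <= D * (42 / 100 * x) + x / 400.
Proof.
move=> /andP[D0 D1] /andP[h1 h2] kE r0 R0 xE x1.
have r1 : r <= 21 / 100 by lra.
(* (1 + 29/250 r) (1 - 9/80 r) >= 1 in this range of r. *)
have kle : kappa <= 1 + 29 / 250 * r.
  have p0 : 0 < 1 - 9 / 80 * r by lra.
  rewrite -(ler_pM2r p0) kE.
  have : r * r <= 21 / 100 * r by rewrite ler_wpM2r.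
  by lra.
pose h' := D * (1 + 29 / 250 * r) + 2 * Rr.
have hh : h <= h'.
  by apply: (le_trans h2); rewrite /h' lerD2r ler_wpM2l.
have sq : h ^+ 2 <= h' ^+ 2 by rewrite ler_pXn2r // nnegrE; lra.
have sq0 : D ^+ 2 <= h ^+ 2 by rewrite ler_pXn2r // nnegrE; lra.
apply/andP; split; first by rewrite subr_ge0.
have rr : r * r <= 21 / 100 * r by rewrite ler_wpM2r.
have DD : D * D <= 7 / 4 * D by rewrite ler_wpM2r.
have RR : Rr * Rr <= 21 / 2000 * Rr by apply: ler_wpM2r; lra.
have DR0 : 0 <= D * Rr by rewrite mulr_ge0 // ltW.
have Dr0 : 0 <= D * r by rewrite mulr_ge0.
have DDr : (D * D) * r <= 7 / 4 * D * r by rewrite ler_wpM2r.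
have DDrr : (D * D) * (r * r) <= (7 / 4 * D) * (21 / 100 * r).
  by rewrite ler_pM // mulr_ge0.
have DRr : (D * Rr) * r <= (D * Rr) * (21 / 100) by rewrite ler_wpM2l.
have : h' ^+ 2 = D * D + 58 / 250 * (D * D * r) + 29 / 250 * (29 / 250) * (D * D * (r * r))
   + 4 * (D * Rr) + 116 / 250 * (D * Rr * r) + 4 * (Rr * Rr).
  by rewrite /h'; ring.
rewrite xE; rewrite !expr2 in sq sq0 *; lra.
Qed.

Lemma dist_le_diam n d (X : 'M[R]_(n, d)) i j : (d <= 3)%N ->
  (forall k l, 0 <= X k l <= 1) -> dist X i j <= 7 / 4.
Proof.
move=> d3 X01; have := @eucl_le_coord R d (X i) (X j) 1 d3 ler01.
rewrite mulr1; apply => l; rewrite ler_norml.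
by have := X01 i l; have := X01 j l; move=> /andP[? ?] /andP[? ?]; apply/andP; split; lra.
Qed.

Lemma thm2_event_det n d (alpha Rr : R) (X : 'M[R]_(n, d)) (g : graph n) :
  (0 < n)%N -> (d <= 3)%N -> (forall k l, 0 <= X k l <= 1) ->
  (forall k, `|cmean X k| <= 1 / 12 * (1 / 100)) ->
  (forall k l, `|cmom X k l - (k == l)%:R / 12| <= 1 / 12 * (1 / 100)) ->
  0 <= R_MDS n d alpha <= Rr -> 0 < Rr ->
  (forall i j, (hop g i j < n)%N /\
    (dist X i j <= Rr * (hop g i j)%:R <=
     dist X i j * (Rr / (Rr - 9 / 80 * R_MDS n d alpha)) + 2 * Rr)) ->
  thm2_event alpha Rr X g.
Proof.
move=> n0 d3 X01 mean_small mom_small; set RM := R_MDS n d alpha => /andP[M0 MR] R0 Hhop.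
split=> [i j|U sig topU]; first by case: (Hhop i j).
set r := RM / Rr; set x := r + 20 * Rr.
have r0 : 0 <= r by rewrite divr_ge0 // ltW.
have x0 : 0 < x by rewrite /x; lra.
have np : 0 < (n%:R : R) by rewrite ltr0n.
set Y := Lmat R n *m X.
have YY : dotm Y Y <= n%:R * (253 / 1000) by exact: dotm_LX_le.
have LY : Lmat R n *m Y = Y by rewrite /Y mulmxA Lmat_idem.
(* Y is already centred and the centring matrix is a contraction, so [Xhat] may be left
   uncentred. *)
suff [S HS] : exists S : 'M[R]_d,
    dotm (Y - Xhat U sig *m S) (Y - Xhat U sig *m S) <= n%:R * (6 * x ^+ 2).
  exists S; have -> : Y - Lmat R n *m Xhat U sig *m S = Lmat R n *m (Y - Xhat U sig *m S).
    by rewrite [RHS]mulmxBr LY [in RHS]mulmxA.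
  have q6 : 0 <= Num.sqrt 6 * x by rewrite mulr_ge0 ?sqrtr_ge0 // ltW.
  rewrite frobE mulrC ler_pdivrMr ?sqrtr_gt0 //.
  rewrite -[x in leRHS](ger0_norm (ltW x0)) -sqrtr_sqr -!sqrtrM ?mulr_ge0 ?(ltW x0) //.
  apply: ler_wsqrtr; apply: le_trans (dotm_Lmat_le n0 _) _.
  by rewrite [leRHS]mulrC.
(* The threshold satisfies 253/1000 <= 6 (21/100)^2, and below it (11/50) x stays well under
   1/13. *)
have [xbig|xsmall] := leP (21 / 100) x.
  exists (0 : 'M[R]_d); rewrite mulmx0 subr0; apply: (le_trans YY); rewrite ler_pM2l //.
  by rewrite expr2; nra.
set M := Mmat Rr g.
have Ms : M^T = M.
  rewrite /M /Mmat linearZ /= !trmx_mul Lmat_tr mulmxA; congr (_ *: (_ *m _ *m _)).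
  apply/matrixP => i j; rewrite !mxE eq_sym hop_sym; by case: eqP.
pose De := Dhat Rr g - Dmat X.
have ME : M - Y *m Y^T = (- (1 / 2)) *: (Lmat R n *m De *m Lmat R n).
  rewrite /De (mulmxBr (Lmat R n)) [(_ - _ *m Dmat X) *m _]mulmxBl Lmat_Dmat //.
  rewrite -/Y scalerBr /M /Mmat scalerA.
  by congr (_ - _); rewrite -[LHS]scale1r; congr (_ *: _); field.
have kE : Rr / (Rr - 9 / 80 * RM) * (1 - 9 / 80 * r) = 1.
  rewrite /r; field; rewrite !gt_eqF //=; first by lra.
have Dle i j : 0 <= De i j <= dist X i j * (42 / 100 * x) + x / 400.
  rewrite !mxE; case: eqVneq => [->|ij].
    have -> : dist X j j = 0 by exact: (euclxx (X j)).
    by rewrite expr0n subr0 lexx mul0r add0r /= divr_ge0 // ltW.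
  have [_ hh] := Hhop i j.
  apply: (@hop_sq_err _ _ r Rr x _ _ hh kE r0 R0) => //; last exact: ltW.
  by rewrite dist_ge0 dist_le_diam.
(* By (a + b)^2 <= 2 a^2 + 2 b^2 the constant is at least 4 (42/100)^2 (253/1000) + 2 / 400^2. *)
have DeDe : dotm De De <= (n%:R * x) ^+ 2 * (179 / 1000).
  have sd := sum_dist_le n0 X; rewrite -/Y in sd.
  set P := 42 / 100 * x in Dle.
  apply: (@le_trans _ _ (\sum_i \sum_j (2 * P ^+ 2 * dist X i j ^+ 2 + 2 * (x / 400) ^+ 2))).
    rewrite dotmE; apply: ler_sum => i _; apply: ler_sum => j _.
    have /andP[e1 e2] := Dle i j.
    apply: (@le_trans _ _ ((dist X i j * P + x / 400) ^+ 2)).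
      by rewrite -expr2 ler_pXn2r ?nnegrE // (le_trans e1).
    have := sqr_ge0 (dist X i j * P - x / 400); move: (dist X i j) (x / 400) => a b.
    by rewrite !expr2; lra.
  under eq_bigr do rewrite big_split /= -mulr_sumr sumr_const card_ord.
  rewrite big_split /= -mulr_sumr sumr_const card_ord -mulrnA -[_ *+ (n * n)]mulr_natl natrM.
  have b1 : 2 * P ^+ 2 * (\sum_i \sum_j dist X i j ^+ 2) <=
      2 * P ^+ 2 * (2 * n%:R * (n%:R * (253 / 1000))).
    apply: ler_wpM2l; first exact: mulr_ge0 _ (sqr_ge0 _).
    by apply: (le_trans sd); rewrite ler_pM2l // mulr_gt0.
  apply: le_trans (lerD b1 (lexx _)) _; rewrite /P.
  have := sqr_ge0 (n%:R * x); rewrite !exprMn !expr2.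
  by move: (n%:R : R) => N; lra.
(* (11/50)^2 exceeds (1/4)(179/1000), the quarter being the square of the factor 1/2 in [Mmat]. *)
pose e := n%:R * (11 / 50 * x); pose lam : R := n%:R * (1 / 13).
have e0 : 0 <= e by rewrite /e !mulr_ge0 // ltW.
have Ele : dotm (M - Y *m Y^T) (M - Y *m Y^T) <= e ^+ 2.
  rewrite ME dotmZl dotmZr.
  have := le_trans (dotm_Lmat2_le n0 De) DeDe.
  set t := dotm _ _; have := sqr_ge0 (n%:R * x); rewrite /e !exprMn !expr2.
  by move: (n%:R : R) => N; lra.
have elam : e < lam by rewrite /e /lam ltr_pM2l //; lra.
have [S HS] := top_eig_perturb Ms topU e0 Ele elam (gram_lower n0 d3 mean_small mom_small).
exists S; move: HS; set z := dotm _ _ => HS.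
have p0 : 0 < (lam - e) ^+ 2 by rewrite exprn_gt0 // subr_gt0.
rewrite -(ler_pM2l p0); apply: (le_trans HS).
have -> : lam * e ^+ 2 = n%:R ^+ 3 * x ^+ 2 * (1 / 13 * (11 / 50) ^+ 2) by rewrite /lam /e; ring.
have -> : (lam - e) ^+ 2 * (n%:R * (6 * x ^+ 2)) =
    n%:R ^+ 3 * x ^+ 2 * (6 * (1 / 13 - 11 / 50 * x) ^+ 2) by rewrite /lam /e; ring.
apply: ler_wpM2l; first exact: mulr_ge0 (exprn_ge0 _ (ltW np)) (sqr_ge0 _).
have u1 : 1 / 13 - 11 / 50 * (21 / 100) <= 1 / 13 - 11 / 50 * x by lra.
have u2 : 0 <= 1 / 13 - 11 / 50 * (21 / 100) :> R by lra.
have := ler_pM u2 u2 u1 u1; rewrite !expr2; lra.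
Qed.

End Deterministic.

(** * Probabilities of the exceptional events *)

Section BadEvents.
Variables (R : realType) (n d m : nat) (alpha beta Rr s : R).
Hypothesis m0 : (0 < m)%N.
Hypothesis d3 : (d <= 3)%N.
Hypothesis alpha01 : 0 < alpha <= 1.
Hypothesis beta0 : 0 <= beta.
Hypothesis s0 : 0 < s.
Hypothesis sR : 32 * s <= Rr.
Hypothesis ms : 70 * m%:R^-1 <= s.
Local Notation cell := {ffun 'I_d -> 'I_m}.
Implicit Types (X : 'M[R]_(n, d)) (i j : 'I_n) (g : graph n).

Let R0 : 0 < Rr. Proof. by apply: lt_le_trans sR; rewrite mulr_gt0. Qed.
Let mi0 : 0 <= (m%:R^-1 : R). Proof. by rewrite invr_ge0 ler0n. Qed.

Definition far_bad X i j g : bool := (Rr < dist X i j) &&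
  ~~ [exists k, adj g i k && (dist X k j <= dist X i j - (Rr - 18 / 5 * s))].

Definition near_bad X i j g : bool := (dist X i j <= Rr) &&
  ~~ [exists k, adj g i k && adj g j k].

(** The box is placed as far along the segment as possible: adding the box radius 7/4 s and the cell
    error 7/4 / m gives exactly [Rr], so all its points are in range of x_i. *)
Definition far_tau (a c : cell) : R := (Rr - 7 / 4 * s - 7 / 4 * m%:R^-1) /
  eucl (fun l => (a l)%:R / m%:R : R) (fun l => (c l)%:R / m%:R).

(** The progress falls short of [Rr] by twice the box radius, 7/2 s, and by four cell errors, 7 / m
    <= s / 10. Together they make 18/5 s, which explains the factor 70 in [ms]. *)
Lemma far_bad_le X i j : i != j -> (forall k l, 0 <= X k l <= 1) ->
  \sum_g graph_weight alpha beta Rr X g * (far_bad X i j g)%:R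
  <= relay_bound alpha s (box_corner far_tau s) i j X.
Proof.
move=> ij X01; have [[s0' sR'] [ms' mi']] := ((s0, sR), (ms, mi0)).
apply: (@prob_fail_le _ _ _ _ m0 _ _ _ alpha01 beta0 R0 X i j true) => //.
move=> a c ai cj [g0 /andP[dR _]] k bk.
have /andP[L1 L2] := cell_dist d3 ai cj.
set L := eucl (fun l => (a l)%:R / m%:R) _ in L1 L2.
rewrite -[eucl (X i) (X j)]/(dist X i j) in L1 L2.
have L0 : 0 < L by lra.
have tL : far_tau a c * L = Rr - 7 / 4 * s - 7 / 4 * m%:R^-1.
  by rewrite /far_tau divfK // gt_eqF.
have t01 : 0 <= far_tau a c <= 1.
  rewrite /far_tau -/L divr_ge0 /=; first by rewrite ler_pdivrMr // mul1r; lra.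
    by lra.
  exact: ltW.
have [h1 h2] := box_dist m0 d3 (ltW s0) t01 ai cj bk.
rewrite -/L in h1 h2.
rewrite -[eucl (X i) (X k)]/(dist X i k) in h1.
rewrite -[eucl (X j) (X k)]/(dist X j k) in h2.
split => //; first by lra.
move=> g _ _; rewrite andbT => aik; rewrite /far_bad negb_and negbK; apply/orP; right.
apply/existsP; exists k; rewrite aik /= dist_sym.
have -> : dist X i j - (Rr - 18 / 5 * s) = dist X i j - Rr + 18 / 5 * s by ring.
by lra.
Qed.

(** Every point of the midpoint box is within Rr / 2 + 7/4 s' plus two cell errors of both ends,
    well below [Rr]. *)
Lemma near_bad_le s' X i j : i != j -> (forall k l, 0 <= X k l <= 1) ->
  0 <= s' -> 32 * s' <= Rr ->
  \sum_g graph_weight alpha beta Rr X g * (near_bad X i j g)%:R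
  <= relay_bound (alpha ^+ 2) s' (box_corner (fun _ _ : cell => 1 / 2) s') i j X.
Proof.
move=> ij X01 s'0 s'R; have [[s0' sR'] [ms' mi']] := ((s0, sR), (ms, mi0)).
apply: (@prob_fail_le _ _ _ _ m0 _ _ _ alpha01 beta0 R0 X i j false) => //.
move=> a c ai cj [g0 /andP[dR _]] k bk.
have /andP[L1 L2] := cell_dist d3 ai cj.
have t01 : 0 <= (1 / 2 : R) <= 1 by apply/andP; split; lra.
have [h1 h2] := box_dist m0 d3 s'0 t01 ai cj bk.
set L := eucl (fun l => (a l)%:R / m%:R) _ in L1 L2 h1 h2.
rewrite -[eucl (X i) (X j)]/(dist X i j) in L1 L2.
rewrite -[eucl (X i) (X k)]/(dist X i k) in h1.
rewrite -[eucl (X j) (X k)]/(dist X j k) in h2.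
split => [|_|]; [by lra|by lra|].
move=> g _ _ aik; rewrite /near_bad negb_and negbK; apply/orP; right.
by apply/existsP; exists k.
Qed.

End BadEvents.

(** * Second moments of empirical means *)

Section Chebyshev.
Variables (R : realType) (n d : nat) (phi : 'I_d -> R -> R).
Hypothesis n0 : (0 < n)%N.
Hypothesis phi_int : forall k,
  (@lebesgue_measure R).-integrable `[0%R, 1%R]%classic (EFin \o phi k).
Hypothesis phi1 : forall k (t : R), 0 <= t <= 1 -> `|phi k t| <= 1.
Variable k0 : 'I_d.
Hypothesis phi0 : Rintegral (@lebesgue_measure R) `[0%R, 1%R]%classic (phi k0) = 0.

Definition emp_mean (X : 'M[R]_(n, d)) : R :=
  n%:R^-1 * \sum_i \prod_k phi k (X i k).

(** The square of [emp_mean] with each diagonal term replaced by its bound 1, so that only products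
    over two distinct nodes remain to be integrated. *)
Definition cheb_bound (X : 'M[R]_(n, d)) : R :=
  n%:R^-1 ^+ 2 * (n%:R + \sum_i \sum_(j | j != i)
     (\prod_k phi k (X i k)) * (\prod_k phi k (X j k))).

Lemma emp_mean_sqr_le (X : 'M[R]_(n, d)) : 
  (forall i k, 0 <= X i k <= 1) -> emp_mean X ^+ 2 <= cheb_bound X.
Proof.
move=> X01; rewrite /emp_mean exprMn; apply: ler_wpM2l; first exact: sqr_ge0.
set f := fun i => \prod_k phi k (X i k).
have f1 i : f i * f i <= 1.
  rewrite -expr2 -real_normK ?num_real // expr_le1 // normr_prod.
  rewrite -[leRHS](_ : \prod_(k < d) 1 = 1); last by rewrite big1.
  by apply: ler_prod => k _; rewrite normr_ge0 phi1.
rewrite expr2 mulr_suml.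
have -> : \sum_i f i * \sum_j f j = \sum_i (f i * f i + \sum_(j | j != i) f i * f j).
  by apply: eq_bigr => i _; rewrite (bigD1 i) //= mulrDr mulr_sumr.
rewrite big_split /= lerD2r -[leRHS](_ : \sum_(i < n) 1 = _); last first.
  by rewrite sumr_const card_ord.
exact: ler_sum.
Qed.

(** Every off-diagonal term integrates to 0 because of the factor at coordinate [k0]; the diagonal
    leaves n / n^2. *)
Lemma cint_cheb_bound : cint (n * d) (fun x => cheb_bound (posX n d x)) n%:R^-1.
Proof.
have -> : n%:R^-1 = n%:R^-1 ^+ 2 * (n%:R + \sum_(i < n) \sum_(j < n | j != i) 0) :> R.
  rewrite big1 ?addr0; last by move=> i _; rewrite big1.
  by rewrite expr2 -mulrA mulVf ?mulr1 // pnatr_eq0 -lt0n.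
apply: cintZ; apply: cintD; first exact: cint_cst.
apply: cint_sum => i _; apply: cint_sum => j ji.
pose f (x : seq R) := \prod_(k < d) phi k (nth 0 x k).
pose c := \prod_(k < d) Rintegral (@lebesgue_measure R) `[0%R, 1%R]%classic (phi k).
have fc : cint d f c by exact: cint_coords.
have c0 : c = 0 by rewrite /c (bigD1 k0) //= phi0 mul0r.
have H := @cint_blocks R n d (fun k => if (k == i) || (k == j) then f else fun=> 1)
  (fun k => if (k == i) || (k == j) then c else 1).
have Pc : \prod_(k < n) (if (k == i) || (k == j) then c else 1) = 0.
  by rewrite (bigD1 i) //= eqxx c0 mul0r.
rewrite Pc in H.
apply: eq_cint (H _).
  move=> x _; rewrite (bigD1 i) //= eqxx (bigD1 j) //= eqxx orbT big1 ?mulr1.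
    by rewrite !posX_block.
  by move=> k /andP[/negbTE -> /negbTE ->].
move=> k; case: ifP => _; first by [].
exact: cint_cst.
Qed.

End Chebyshev.

Section Moments.
Variables (R : realType) (n d : nat).
Hypothesis n0 : (0 < n)%N.
Local Notation mu := (@lebesgue_measure R).
Local Notation I01 := (`[0%R, 1%R]%classic : set R).

Definition lin01 (t : R) : R := t - 1 / 2.
Definition quad01 (t : R) : R := (t - 1 / 2) * (t - 1 / 2) - 1 / 12.

Lemma lin01_int : mu.-integrable I01 (EFin \o lin01) /\ Rintegral mu I01 lin01 = 0.
Proof.
pose p : {poly R} := (1 / 2) *: ('X ^+ 2 - 'X).
have e : lin01 = fun t => p^`().[t].
  apply/funext => t; rewrite /p derivZ derivB derivXn derivX /= !hornerE.
  by rewrite /lin01 -mulr_natl !hornerE; field.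
have [ip ep] := poly01 p; rewrite e; split => //; rewrite ep /p !hornerE.
by rewrite ?expr1n ?expr0n /=; ring.
Qed.

Lemma quad01_int : mu.-integrable I01 (EFin \o quad01) /\ Rintegral mu I01 quad01 = 0.
Proof.
pose p : {poly R} := (1 / 3) *: 'X ^+ 3 - (1 / 2) *: 'X ^+ 2 + (1 / 6) *: 'X.
have e : quad01 = fun t => p^`().[t].
  apply/funext => t; rewrite /p derivD derivB !derivZ !derivXn derivX.
  rewrite hornerD hornerD hornerN !hornerZ !hornerMn !hornerXn -polyC1 hornerC /=.
  by rewrite /quad01; field.
have [ip ep] := poly01 p; rewrite e; split => //; rewrite ep /p !hornerE.
by rewrite ?expr1n ?expr0n /=; field.
Qed.

Definition mean_phi (k l : 'I_d) : R -> R := if l == k then lin01 else cst 1.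
Definition mom_phi (k k' l : 'I_d) : R -> R :=
  if k == k' then (if l == k then quad01 else cst 1)
  else if (l == k) || (l == k') then lin01 else cst 1.

Lemma emp_mean_cmean k (X : 'M[R]_(n, d)) : emp_mean (mean_phi k) X = cmean X k.
Proof.
rewrite /emp_mean /cmean; congr (_ * _); apply: eq_bigr => i _.
rewrite (bigD1 k) //= /mean_phi eqxx big1 ?mulr1 //.
by move=> l /negbTE ->.
Qed.

Lemma emp_mean_cmom k k' (X : 'M[R]_(n, d)) :
  emp_mean (mom_phi k k') X = cmom X k k' - (k == k')%:R / 12.
Proof.
rewrite /emp_mean /cmom /mom_phi; case: eqVneq => [<-|kk'].
  rewrite mulr1n.
  have -> : (1 / 12 : R) = n%:R^-1 * \sum_(i < n) (1 / 12).
    rewrite sumr_const card_ord -[(1 / 12) *+ n]mulr_natl [RHS]mulrA mulVf.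
      by rewrite [RHS]mul1r.
    by rewrite pnatr_eq0 -lt0n.
  rewrite -mulrBr -sumrB; congr (_ * _); apply: eq_bigr => i _.
  rewrite (bigD1 k) //= eqxx big1 ?mulr1 //.
  by move=> l /negbTE ->.
rewrite mul0r subr0; congr (_ * _); apply: eq_bigr => i _.
rewrite (bigD1 k) //= eqxx (bigD1 k') 1?eq_sym //= eqxx orbT big1 ?mulr1 //.
by move=> l /andP[/negbTE -> /negbTE ->].
Qed.

Lemma lin01_le1 t : 0 <= t <= 1 -> `|lin01 t| <= 1.
Proof. by move=> /andP[? ?]; rewrite /lin01 ler_norml; apply/andP; split; lra. Qed.

Lemma quad01_le1 t : 0 <= t <= 1 -> `|quad01 t| <= 1.
Proof.
move=> /andP[? ?]; rewrite /quad01 ler_norml.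
by have h := sqr_ge0 (t - 1 / 2); rewrite expr2 in h; apply/andP; split; nra.
Qed.

Lemma mean_phi_P k : [/\ forall l, mu.-integrable I01 (EFin \o mean_phi k l),
  forall l t, 0 <= t <= 1 -> `|mean_phi k l t| <= 1 & Rintegral mu I01 (mean_phi k k) = 0].
Proof.
have [i1 i2] := lin01_int; split; rewrite /mean_phi.
- by move=> l; case: ifP => _ //; exact: integrable01_cst.
- by move=> l t t01; case: ifP => _; [exact: lin01_le1|rewrite normr1].
- by rewrite eqxx.
Qed.

Lemma mom_phi_P k k' : [/\ forall l, mu.-integrable I01 (EFin \o mom_phi k k' l),
  forall l t, 0 <= t <= 1 -> `|mom_phi k k' l t| <= 1 & Rintegral mu I01 (mom_phi k k' k) = 0].
Proof.
have [i1 i2] := lin01_int; have [j1 j2] := quad01_int; split; rewrite /mom_phi.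
- by move=> l; do 2! case: ifP => _ //; exact: integrable01_cst.
- move=> l t t01; case: ifP => _; case: ifP => _; rewrite ?normr1 //.
    exact: quad01_le1.
  exact: lin01_le1.
- by rewrite eqxx /=; case: ifP.
Qed.

End Moments.

(** * Conclusion *)

Section Assembly.
Variables (R : realType) (n d : nat) (alpha beta Rr : R).
Hypothesis n4 : (4 <= n)%N.
Hypothesis d0 : (0 < d)%N.
Hypothesis d3 : (d <= 3)%N.
Hypothesis alpha01 : 0 < alpha <= 1.
Hypothesis beta0 : 0 <= beta.
Hypothesis ln_small : 12 * ln (n%:R : R) <= alpha ^+ 2 * (1 / 2) ^+ d * (n%:R - 2).
Hypothesis Rr_large : powR alpha^-1 (d%:R)^-1 * R_MDS n d alpha < Rr.

Let a0 : 0 < alpha. Proof. by case/andP: alpha01. Qed.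
Let a1 : alpha <= 1. Proof. by case/andP: alpha01. Qed.
Let n0 : (0 < n)%N. Proof. exact: leq_trans n4. Qed.
Let nR4 : 4 <= (n%:R : R). Proof. by rewrite ler_nat. Qed.
Let np : 0 < (n%:R : R). Proof. by rewrite ltr0n. Qed.
Let n2 : (n - 2)%:R = n%:R - 2 :> R.
Proof. by rewrite natrB // (leq_trans _ n4). Qed.
Let n2p : 0 < (n%:R - 2 : R). Proof. by have := nR4; lra. Qed.
Let dn0 : (d%:R : R) != 0. Proof. by rewrite pnatr_eq0 -lt0n. Qed.

Let rad : R := powR (12 * ln (n%:R) / (alpha * (n%:R - 2))) (d%:R)^-1.
(** Side of the box for near pairs. [Rr] has no upper bound, so the side is capped for the box to
    fit into the cube. *)
Let rad' : R := Num.min (Rr / 32) (1 / 2).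

Let R_MDS_E : R_MDS n d alpha = 32 * rad. Proof. by []. Qed.

Let powRK (x : R) : 0 <= x -> powR x (d%:R)^-1 ^+ d = x.
Proof.
by move=> x0; rewrite -powR_mulrn ?powR_ge0 // -powRrM mulVf // powRr1.
Qed.

Let lnn : 3 / 4 <= ln (n%:R : R).
Proof.
have h : -1 < (n%:R^-1 - 1 : R) by rewrite ltrBrDr addNr invr_gt0.
have := le_ln1Dx h; rewrite addrC subrK lnV ?posrE //.
have : n%:R^-1 <= 4^-1 :> R by rewrite lef_pV2 ?posrE.
by lra.
Qed.

Let arg0 : 0 < 12 * ln (n%:R) / (alpha * (n%:R - 2)) :> R.
Proof. by apply: divr_gt0; [have := lnn; lra | exact: mulr_gt0 a0 n2p]. Qed.

Let rad0 : 0 < rad. Proof. exact: powR_gt0. Qed.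

Let radd : alpha * rad ^+ d * (n%:R - 2) = 12 * ln (n%:R).
Proof.
rewrite /rad powRK ?(ltW arg0) //.
have [h1 h2] := (gt_eqF a0, gt_eqF n2p).
by field; rewrite h1 h2.
Qed.

Let rad_half : rad <= 1 / 2.
Proof.
rewrite -(@ler_pXn2r _ d) ?nnegrE //; first last.
- exact: ltW.
have p0 : 0 < alpha * (n%:R - 2) by exact: mulr_gt0 a0 n2p.
rewrite -(ler_pM2l p0).
have -> : alpha * (n%:R - 2) * rad ^+ d = 12 * ln (n%:R) by rewrite -radd; ring.
apply: (le_trans ln_small).
have h0 : 0 <= (1 / 2) ^+ d :> R by apply: exprn_ge0; lra.
have -> : alpha ^+ 2 * (1 / 2) ^+ d * (n%:R - 2) =
   alpha * (alpha * (n%:R - 2) * (1 / 2) ^+ d) by ring.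
by apply: ler_piMl => //; rewrite mulr_ge0 // ltW.
Qed.

Let rad_R : 32 * rad <= Rr.
Proof.
apply: ltW; apply: le_lt_trans Rr_large; rewrite R_MDS_E ler_peMl //.
  by rewrite mulr_ge0 // ltW.
rewrite -[leLHS](_ : powR 1 (d%:R)^-1 = 1); last by rewrite powR1.
apply: ge0_ler_powR; rewrite // ?nnegrE ?invr_ge0 ?ler0n //; first exact: ltW.
by rewrite invf_ge1.
Qed.

Let Rr0 : 0 < Rr. Proof. by apply: lt_le_trans rad_R; rewrite mulr_gt0. Qed.

Let rad'0 : 0 <= rad'.
Proof. by rewrite le_min divr_ge0 ?(ltW Rr0) //=; lra. Qed.

Let rad'_half : rad' <= 1 / 2. Proof. by rewrite ge_min lexx orbT. Qed.

Let rad'_R : 32 * rad' <= Rr.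
Proof.
have : rad' <= Rr / 32 by rewrite ge_min lexx.
by lra.
Qed.

(** Without the cap this is [Rr_large] raised to the power d, which supplies the second factor
    [alpha]; with the cap it is [ln_small]. *)
Let rad'd : 12 * ln (n%:R) <= alpha ^+ 2 * rad' ^+ d * (n%:R - 2).
Proof.
rewrite /rad' /Num.min; case: ifP => _ //.
rewrite -radd ler_pM2r // expr2 -mulrA ler_pM2l //.
have hR : powR alpha^-1 (d%:R)^-1 * rad <= Rr / 32.
  by have := ltW Rr_large; rewrite R_MDS_E; lra.
have pr0 : 0 <= powR alpha^-1 (d%:R)^-1 * rad.
  exact: mulr_ge0 (powR_ge0 _ _) (ltW rad0).
have : (powR alpha^-1 (d%:R)^-1 * rad) ^+ d <= (Rr / 32) ^+ d.
  by rewrite ler_pXn2r ?nnegrE // divr_ge0 // ltW.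
rewrite exprMn (@powRK alpha^-1) ?invr_ge0 ?(ltW a0) // => h.
by rewrite -ler_pdivrMl.
Qed.

(** Distances are at most 7/4, so this is what [hop_bounds] needs. It holds since rad >= rad^d >= 1
    / (n - 2), while each step gains more than 28 rad. *)
Let diam_step : 7 / 4 < Rr + (n%:R - 3) * (Rr - 18 / 5 * rad).
Proof.
have rd : (n%:R - 2)^-1 <= rad.
  apply: (@le_trans _ _ (rad ^+ d)); last first.
    rewrite -[leRHS]expr1; apply: ler_wiXn2l => //; first exact: ltW.
    by have := rad_half; lra.
  rewrite -[leLHS]mul1r ler_pdivrMr //.
  have h : 1 <= alpha * rad ^+ d * (n%:R - 2) by rewrite radd; have := lnn; lra.
  apply: (le_trans h); rewrite ler_pM2r // ler_piMl //.
  by rewrite exprn_ge0 // ltW.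
have h : 1 <= rad * (n%:R - 2) by rewrite -ler_pdivrMr // mul1r.
have p : 0 <= (n%:R - 4) * rad by rewrite mulr_ge0 ?subr_ge0 // ltW.
have q : 0 <= (n%:R - 3) * (Rr - 32 * rad).
  by rewrite mulr_ge0 ?subr_ge0 // (le_trans _ nR4) // ler_nat.
by have := Rr0; lra.
Qed.

(** By 1 - q <= exp (- q). The exponent 3 is enough: summing over at most n^2 ordered pairs leaves a
    multiple of 1 / n. *)
Let pow_small (q : R) : 0 <= q <= 1 -> 12 * ln (n%:R) <= q * (n%:R - 2) ->
  (1 - q) ^+ (n - 2) <= n%:R^-1 ^+ 3.
Proof.
move=> /andP[q0 q1] h.
apply: (@le_trans _ _ (expR (- q) ^+ (n - 2))).
  by rewrite lerXn2r ?nnegrE ?subr_ge0 ?expR_ge0 // expR_ge1Dx.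
have -> : n%:R^-1 ^+ 3 = expR (- (3 * ln (n%:R : R))).
  by rewrite expRN expRM_natl lnK ?posrE // exprVn.
rewrite -expRM_natl ler_expR n2.
by have := lnn; lra.
Qed.

Let m := (Num.truncn (70 / rad)).+1.
Let m0 : (0 < m)%N. Proof. by []. Qed.
Let ms : 70 * m%:R^-1 <= rad.
Proof.
have mp : 0 < (m%:R : R) by rewrite ltr0n.
rewrite ler_pdivrMr // mulrC -ler_pdivrMr //.
exact/ltW/truncnS_gt.
Qed.

Let eps : R := 1 / 12 * (1 / 100).

Let relay_far i j := @relay_bound R n d m alpha rad
  (box_corner (@far_tau R d m Rr rad) rad) i j.
Let relay_near i j := @relay_bound R n d m (alpha ^+ 2) rad'
  (box_corner (fun _ _ => 1 / 2) rad') i j.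

(** A union bound over pairs, plus a Markov term that reaches 1 as soon as one empirical moment is
    off by more than [eps]. *)
Let fail_bound (X : 'M[R]_(n, d)) : R :=
  \sum_i \sum_(j | j != i) (relay_far i j X + relay_near i j X)
  + eps^-1 ^+ 2 * (\sum_k cheb_bound (mean_phi k) X
                   + \sum_k \sum_l cheb_bound (mom_phi k l) X).

Let fail_int : R :=
  \sum_(i < n) \sum_(j < n | j != i)
     ((1 - alpha * rad ^+ d) ^+ (n - 2) + (1 - alpha ^+ 2 * rad' ^+ d) ^+ (n - 2))
  + eps^-1 ^+ 2 * (\sum_(k < d) n%:R^-1 + \sum_(k < d) \sum_(l < d) n%:R^-1).

Let cint_fail : cint (n * d) (fun x => fail_bound (posX n d x)) fail_int.
Proof.
apply: cintD.
  apply: cint_sum => i _; apply: cint_sum => j ji.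
  apply: cintD; apply: cint_relay_bound => //; rewrite 1?eq_sym //.
  - exact: ltW.
  - by move=> a c l; apply: box_corner_itv; rewrite ltW.
  - by move=> a c l; apply: box_corner_itv; rewrite rad'0 rad'_half.
apply: cintZ; apply: cintD.
  apply: cint_sum => k _; have [h1 h2 h3] := @mean_phi_P R d k.
  exact: cint_cheb_bound h3.
apply: cint_sum => k _; apply: cint_sum => l _; have [h1 h2 h3] := @mom_phi_P R d k l.
exact: cint_cheb_bound h3.
Qed.

Let fail_int_le : fail_int <= (2 + 12 * eps^-1 ^+ 2) * n%:R^-1.
Proof.
have e0 : 0 <= eps^-1 ^+ 2 by exact: sqr_ge0.
have d3R : (d%:R : R) <= 3 by rewrite ler_nat.
have p1 : (1 - alpha * rad ^+ d) ^+ (n - 2) <= n%:R^-1 ^+ 3.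
  apply: pow_small; last by rewrite radd.
  rewrite mulr_ge0 ?exprn_ge0 ?(ltW a0) ?(ltW rad0) //= mulr_ile1 ?(ltW a0) //.
    by rewrite exprn_ge0 // ltW.
  by rewrite exprn_ile1 ?(ltW rad0) //; have := rad_half; lra.
have p2 : (1 - alpha ^+ 2 * rad' ^+ d) ^+ (n - 2) <= n%:R^-1 ^+ 3.
  apply: pow_small => //.
  rewrite mulr_ge0 ?exprn_ge0 ?(ltW a0) ?rad'0 //= mulr_ile1 ?exprn_ge0 ?(ltW a0) ?rad'0 //.
    by rewrite exprn_ile1 // ltW.
  by rewrite exprn_ile1 ?rad'0 //; have := rad'_half; lra.
have ni0 : 0 <= n%:R^-1 :> R by rewrite invr_ge0 ltW.
rewrite /fail_int mulrDl; apply: lerD.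
  apply: (@le_trans _ _ (\sum_(i < n) \sum_(j < n) 2 * n%:R^-1 ^+ 3)).
    apply: ler_sum => i _; rewrite big_mkcond /=; apply: ler_sum => j _.
    by case: ifP => _; [lra | rewrite mulr_ge0 ?exprn_ge0].
  rewrite !sumr_const !card_ord -mulrnA -[_ *+ (n * n)]mulr_natl natrM.
  rewrite le_eqVlt; apply/orP; left; apply/eqP.
  by field; rewrite gt_eqF.
have -> : \sum_(k < d) n%:R^-1 + \sum_(k < d) \sum_(l < d) n%:R^-1 =
    (d%:R + d%:R * d%:R) * n%:R^-1 :> R.
  rewrite !sumr_const !card_ord -mulrnA -[n%:R^-1 *+ d]mulr_natl.
  by rewrite -[n%:R^-1 *+ (d * d)]mulr_natl natrM mulrDl.
rewrite [12 * _]mulrC -[_ * 12 * _]mulrA; apply: ler_wpM2l => //; apply: ler_wpM2r => //.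
have : d%:R * d%:R <= 3 * 3 :> R by rewrite ler_pM ?ler0n.
by lra.
Qed.

(** The moments depend on the positions alone. If one of them is off, the left side is at most 0;
    otherwise the union bound over pairs applies to the random graph. *)
Let fail_pointwise (X : 'M[R]_(n, d)) : (forall i k, 0 <= X i k <= 1) ->
  1 - fail_bound X <= \sum_g graph_weight alpha beta Rr X g *
     (`[< thm2_event alpha Rr X g >])%:R.
Proof.
move=> X01; set w := graph_weight alpha beta Rr X.
have w0 g : 0 <= w g by exact: graph_weight_ge0.
have w1 : \sum_g w g = 1 by exact: graph_weight_sum.
have e2 : 0 < eps^-1 ^+ 2 by rewrite exprn_gt0 // invr_gt0 /eps; lra.
have far_ge i j : j != i -> \sum_g w g * (far_bad Rr rad X i j g)%:R <= relay_far i j X.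
  by move=> ji; apply: far_bad_le => //; rewrite eq_sym.
have near_ge i j : j != i -> \sum_g w g * (near_bad Rr X i j g)%:R <= relay_near i j X.
  by move=> ji; apply: (@near_bad_le _ _ _ _ _ _ _ rad) => //; rewrite eq_sym.
have rf0 i j : j != i -> 0 <= relay_far i j X + relay_near i j X.
  move=> ji; apply: addr_ge0; [apply: le_trans (far_ge _ _ ji)|apply: le_trans (near_ge _ _ ji)];
  by apply: sumr_ge0 => g _; rewrite mulr_ge0 // ler0n.
have mean0 k : cmean X k ^+ 2 <= cheb_bound (mean_phi k) X.
  have [_ h2 _] := @mean_phi_P R d k.
  by rewrite -emp_mean_cmean; exact: emp_mean_sqr_le.
have mom0 k l : (cmom X k l - (k == l)%:R / 12) ^+ 2 <= cheb_bound (mom_phi k l) X.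
  have [_ h2 _] := @mom_phi_P R d k l.
  by rewrite -emp_mean_cmom //; exact: emp_mean_sqr_le.
have mean00 k : 0 <= cheb_bound (mean_phi k) X by exact: le_trans (sqr_ge0 _) (mean0 k).
have mom00 k l : 0 <= cheb_bound (mom_phi k l) X by exact: le_trans (sqr_ge0 _) (mom0 k l).
have rhs0 : 0 <= \sum_g w g * (`[< thm2_event alpha Rr X g >])%:R.
  by apply: sumr_ge0 => g _; rewrite mulr_ge0 // ler0n.
pose A := \sum_i \sum_(j | j != i) (relay_far i j X + relay_near i j X).
pose B := \sum_k cheb_bound (mean_phi k) X + \sum_k \sum_l cheb_bound (mom_phi k l) X.
have A0 : 0 <= A by apply: sumr_ge0 => i _; apply: sumr_ge0 => j; exact: rf0.
have B0 : 0 <= B.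
  by apply: addr_ge0; apply: sumr_ge0 => // k _; apply: sumr_ge0.
have FE : fail_bound X = A + eps^-1 ^+ 2 * B by [].
have big (t : R) : eps < `|t| -> t ^+ 2 <= B -> 1 - fail_bound X <= 0.
  move=> et tB; have : 1 <= eps^-1 ^+ 2 * B; last by rewrite FE; lra.
  apply: (@le_trans _ _ (eps^-1 ^+ 2 * t ^+ 2)); last by rewrite ler_pM2l.
  have ep : 0 < eps by rewrite /eps; lra.
  rewrite -exprMn -real_normK ?num_real // exprn_ege1 // normrM gtr0_norm ?invr_gt0 //.
  by rewrite mulrC ler_pdivlMr // mul1r ltW.
have [mean_small|] := pselect (forall k, `|cmean X k| <= eps); last first.
  move=> /existsNP [k /negP]; rewrite -ltNge => ek; apply: le_trans rhs0; apply: big ek _.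
  apply: (le_trans (mean0 k)); rewrite /B (bigD1 k) //= -!addrA lerDl.
  by rewrite !addr_ge0 // sumr_ge0 // => k' _; apply: sumr_ge0.
have [mom_small|] := pselect (forall k l, `|cmom X k l - (k == l)%:R / 12| <= eps); last first.
  move=> /existsNP [k /existsNP [l /negP]]; rewrite -ltNge => ek.
  apply: le_trans rhs0; apply: big ek _; apply: (le_trans (mom0 k l)).
  apply: (@le_trans _ _ (\sum_k \sum_l cheb_bound (mom_phi k l) X)); last first.
    by rewrite lerDr sumr_ge0.
  rewrite (bigD1 k) //= (bigD1 l) //= -addrA lerDl addr_ge0 ?sumr_ge0 // => k' _.
  exact: sumr_ge0.
(* Nonzero weight ensures that no edge is longer than [Rr], as the lower bound on hop counts
   requires; the other graphs drop out of the sum. *)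
have good g : w g != 0 ->
    (forall i j, j != i -> ~~ far_bad Rr rad X i j g /\ ~~ near_bad Rr X i j g) ->
    thm2_event alpha Rr X g.
  move=> wg0 ok; have el := graph_weight_edge wg0.
  have [[r0' rR'] rr'] := (rad0, rad_R, Rr0).
  apply: thm2_event_det => //.
    by rewrite R_MDS_E mulr_ge0 ?(ltW rad0) //= rad_R.
  have stepE : Rr - 9 / 80 * R_MDS n d alpha = Rr - 18 / 5 * rad.
    by rewrite R_MDS_E; field.
  rewrite stepE => i j.
  apply: hop_bounds => //.
  - by lra.
  - move=> i' j' ij dR; have [] := ok i' j'; first by rewrite eq_sym.
    rewrite /far_bad dR /= negbK => /existsP [k /andP[h1 h2]] _; by exists k.
  - move=> i' j' ij dR; have [] := ok i' j'; first by rewrite eq_sym.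
    rewrite /near_bad dR /= negbK => _ /existsP [k /andP[h1 h2]]; by exists k.
  - by apply/andP; split; lra.
  - exact: le_lt_trans (dist_le_diam _ _ d3 X01) diam_step.
  - exact: leq_trans n4.
have term g : w g * (1 - (`[< thm2_event alpha Rr X g >])%:R) <=
    \sum_i \sum_(j | j != i) (w g * (far_bad Rr rad X i j g)%:R
                              + w g * (near_bad Rr X i j g)%:R).
  have t0 i j : 0 <= w g * (far_bad Rr rad X i j g)%:R + w g * (near_bad Rr X i j g)%:R.
    by rewrite addr_ge0 // mulr_ge0 // ler0n.
  have S0 : 0 <= \sum_i \sum_(j | j != i) (w g * (far_bad Rr rad X i j g)%:R
                              + w g * (near_bad Rr X i j g)%:R).
    by apply: sumr_ge0 => i _; apply: sumr_ge0.
  case: asboolP => [_|nE]; first by rewrite subrr mulr0.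
  rewrite subr0 mulr1; have [wg0|wg0] := eqVneq (w g) 0.
    by apply: le_trans S0; rewrite wg0.
  have : ~ (forall i j, j != i -> ~~ far_bad Rr rad X i j g /\ ~~ near_bad Rr X i j g).
    by move=> /(good _ wg0).
  move=> /existsNP [i /existsNP [j /not_implyP [ji /not_andP nb]]].
  rewrite (bigD1 i) //= (bigD1 j) //= -addrA.
  have one : w g <= w g * (far_bad Rr rad X i j g)%:R + w g * (near_bad Rr X i j g)%:R.
    by case: nb => /negP; rewrite negbK => ->; rewrite mulr1 ?lerDl ?lerDr mulr_ge0 // ler0n.
  apply: (le_trans one); rewrite lerDl; apply: addr_ge0; first exact: sumr_ge0.
  by apply: sumr_ge0 => i' _; apply: sumr_ge0.
have : \sum_g w g * (1 - (`[< thm2_event alpha Rr X g >])%:R) <= A.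
  apply: (le_trans (ler_sum _ (fun g _ => term g))).
  rewrite exchange_big /=; apply: ler_sum => i _; rewrite exchange_big /=.
  apply: ler_sum => j ji; rewrite big_split /=; apply: lerD; [exact: far_ge|exact: near_ge].
have -> : \sum_g w g * (1 - (`[< thm2_event alpha Rr X g >])%:R) =
    1 - \sum_g w g * (`[< thm2_event alpha Rr X g >])%:R.
  by rewrite -[X in _ = X - _]w1 -sumrB; apply: eq_bigr => g _; rewrite mulrBr mulr1.
have : 0 <= eps^-1 ^+ 2 * B by rewrite mulr_ge0 // ltW.
by rewrite FE; lra.
Qed.

Lemma model_prob_bounds :
  1 - (2 + 12 * (1 / 12 * (1 / 100))^-1 ^+ 2) * n%:R^-1
  <= model_prob alpha beta Rr (@thm2_event R n d alpha Rr) <= 1.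
Proof.
have c1 : cint (n * d) (fun x => 1 - fail_bound (posX n d x)) (1 - fail_int).
  have := cintD (cint_cst (n * d) 1) (cintZ (-1) cint_fail).
  by rewrite mulN1r; apply: eq_cint => x _; rewrite mulN1r.
have pos01 x : in_cube (n * d) x -> forall i k, 0 <= posX n d x i k <= 1.
  by move=> xc i k; rewrite mxE; exact: in_cube_nth xc.
have [] := le_cube_int c1 (f := fun x => \sum_(g : graph n)
   graph_weight alpha beta Rr (posX n d x) g *
   (`[< thm2_event alpha Rr (posX n d x) g >])%:R).
- move=> x xc; rewrite sumr_ge0 /=; last first.
    by move=> g _; rewrite mulr_ge0 ?ler0n //; exact: graph_weight_ge0.
  rewrite -[leRHS](graph_weight_sum alpha beta Rr (posX n d x)).
  apply: ler_sum => g _; rewrite -[leRHS]mulr1; apply: ler_wpM2l.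
    exact: graph_weight_ge0.
  by rewrite lern1; case: asboolP.
- by move=> x xc; apply: fail_pointwise; exact: pos01.
move=> /andP[_ h1] h2; rewrite /model_prob h1 andbT; apply: le_trans h2.
by rewrite lerD2l lerN2 fail_int_le.
Qed.

End Assembly.

(** With t = sqrt n, ln n = 2 ln t <= 2 t. Once t >= 48 / c this gives 12 ln n <= c n / 2, which is
    at most c (n - 2) for n >= 4. *)
Lemma ln_nat_le (R : realType) (c : R) : 0 < c ->
  \forall n \near \oo, 12 * ln (n%:R : R) <= c * (n%:R - 2).
Proof.
move=> c0; exists (Num.truncn ((48 / c) ^+ 2)).+4 => // n /= Nn.
have n4 : 4 <= (n%:R : R) by rewrite ler_nat (leq_trans _ Nn).
have np : 0 < (n%:R : R) by lra.
pose t := Num.sqrt (n%:R : R).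
have tE : t ^+ 2 = n%:R by rewrite sqr_sqrtr // ltW.
have t0 : 0 < t by rewrite sqrtr_gt0.
have lt : ln (n%:R : R) <= 2 * t.
  rewrite -tE lnXn // -[ln t *+ 2]mulr_natl ler_pM2l //.
  exact/ltW/ln_sublinear.
have ct : 48 / c <= t.
  rewrite -(@ler_pXn2r _ 2) ?nnegrE ?(ltW t0) // ?divr_ge0 ?(ltW c0) // tE.
  apply: (le_trans (ltW (truncnS_gt _))); rewrite ler_nat.
  exact: leq_trans (leq_addl 3 _) Nn.
have h : 48 * t <= c * n%:R.
  by rewrite -tE expr2 mulrA ler_pM2r // mulrC -ler_pdivrMr.
have : 0 <= c * (n%:R - 4) by rewrite mulr_ge0 ?subr_ge0 // ltW.
by lra.
Qed.

Unset Implicit Arguments.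

Theorem theorem2 (R : realType) (d : nat) (alpha beta : R) (Rr : nat -> R) :
  (d = 2%N \/ d = 3%N) ->
  0 < alpha <= 1 ->
  0 <= beta < d%:R ->
  (\forall n \near \oo,
      powR alpha^-1 (d%:R)^-1 * R_MDS n d alpha < Rr n) ->
  ((fun n => model_prob alpha beta (Rr n) (@thm2_event R n d alpha (Rr n)))
     : R^nat) @ \oo --> (1 : R^o).
Proof.
move=> d23 alpha01 /andP[beta0 _] HR.
have d0 : (0 < d)%N by case: d23 => ->.
have d3 : (d <= 3)%N by case: d23 => ->.
have /andP[a0 _] := alpha01.
have c0 : 0 < alpha ^+ 2 * (1 / 2) ^+ d by rewrite mulr_gt0 ?exprn_gt0 //; lra.
pose K : R := 2 + 12 * (1 / 12 * (1 / 100))^-1 ^+ 2.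
apply/cvgrPdist_le => e e0; near=> n.
have n4 : (4 <= n)%N by near: n; exists 4%N.
have ln_small : 12 * ln (n%:R : R) <= alpha ^+ 2 * (1 / 2) ^+ d * (n%:R - 2).
  by near: n; exact: ln_nat_le.
have R_large : powR alpha^-1 (d%:R)^-1 * R_MDS n d alpha < Rr n by near: n.
have /andP[] := model_prob_bounds n4 d0 d3 alpha01 beta0 ln_small R_large.
rewrite -/K => h1 h2.
rewrite ger0_norm ?subr_ge0 //; apply: (@le_trans _ _ (K * n%:R^-1)); first by lra.
near: n; exists (Num.truncn (K / e)).+1 => // n /= Kn.
have np : 0 < (n%:R : R) by rewrite ltr0n (leq_trans _ Kn).
rewrite ler_pdivrMr // mulrC -ler_pdivrMr //.
by apply: (le_trans (ltW (truncnS_gt _))); rewrite ler_nat.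
Unshelve. all: by end_near. Qed.
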